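(* Let $X$ be a set equipped with a virtual tribracket structure $([\,,,],\langle\,,,\rangle)$. Let $D$ be an oriented virtual link diagram in the plane and let $D'$ be obtained from $D$ by a single oriented classical or virtual Reidemeister move, supported in a closed disk $\Delta$ (so that $D$ and $D'$ coincide outside $\Delta$). Then for every $X$-coloring $f$ of $D$ there exists a unique $X$-coloring $f'$ of $D'$ which agrees with $f$ outside $\Delta$; that is, such that for every point $p$ of the plane outside $\Delta$ and not on the diagram, the region of $D'$ containing $p$ has the same color under $f'$ as the region of $D$ containing $p$ has under $f$.
   Context: **Virtual tribracket.** A virtual tribracket structure on a set $X$ is a pair of ternary operations $[\,,,]:X\times X\times X\to X$ and $\langle\,,,\rangle:X\times X\times X\to X$ such that: (i) in each of the equations $[a,b,c]=d$ and $\langle a,b,c\rangle=d$, any three of the four elements $a,b,c,d\in X$ determine the fourth (i.e. for any choice of values in $X$ for three of the variables there is exactly one value in $X$ of the remaining variable for which the equation holds); (ii) for all $a,b,c,d\in X$: - $\langle a,\langle a,b,c\rangle,c\rangle=b$; - $[a,b,[b,c,d]]=[a,[a,b,c],[[a,b,c],c,d]]$; - $[[a,b,c],c,d]=[[a,b,[b,c,d]],[b,c,d],d]$; - $\langle a,b,\langle b,c,d\rangle\rangle=\langle a,\langle a,b,c\rangle,\langle\langle a,b,c\rangle,c,d\rangle\rangle$; - $\langle\langle a,b,c\rangle,c,d\rangle=\langle\langle a,b,\langle b,c,d\rangle\rangle,\langle b,c,d\rangle,d\rangle$; - $[a,b,\langle b,c,d\rangle]=\langle a,\langle a,b,c\rangle,[\langle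 a,b,c\rangle,c,d]\rangle$; - $[\langle a,b,c\rangle,c,d]=\langle[a,b,\langle b,c,d\rangle],\langle b,c,d\rangle,d\rangle$. **Diagrams and regions.** An oriented virtual link diagram is a generic immersion of finitely many oriented circles in the plane, with finitely many transverse double points, each marked either as a classical crossing (with over/under information, hence a sign, positive or negative) or as a virtual crossing (no over/under information). Its regions are the connected components of the complement in the plane of the image of the immersion (double points of both kinds are regarded as vertices of the underlying plane graph). **Colorings.** Near any crossing, rotate so that both strands point in a common general direction of travel. The four local quadrants are then: the *incoming* quadrant (between the two incoming ends), the *outgoing* quadrant (between the two outgoing ends), and the *left* and *right* quadrants, as seen facing the direction of travel. Let $\ell,r,i,o$ be the colors of the regions containing the left, right, incoming and outgoing quadrants respectively. An $X$-coloring (virtual tribracket coloring) of a diagram is an assignment of an element of $X$ to each region such that - at every positive classical crossing, $[\ell,i,r]=o$; - at every negative classical crossing, $[\ell,o,r]=i$; - at every virtual crossing, $\langle \ell,i,r\rangle=o$ (equivalently, by $\langle a,\langle a,b,c\rangle,c\rangle=b$, $\langle \ell,o,r\rangle=i$). **Moves.** The oriented classical and virtual Reidemeister moves are the following local moves and their inverses, with all possible orientations of strands: - the classical Reidemeister moves I (adding/removing a kink with one classical crossing), II (adding/removing a bigon with two classical crossings in which one strand is over the other at both), III (moving a strand past a classical crossing of two other strands, where the three strands are respectively top, middle and bottom); - the virtual moves I, II, III, which are the analogous moves with all crossings involved virtual; - the mixed move, in which a strand crossing two other strands only at virtual crossings is moved past a classical crossing of those two strands. *)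

(* Defs.v *)
From mathcomp Require Import all_boot all_order all_algebra.
From mathcomp Require Import all_classical all_reals all_analysis.

Set Implicit Arguments.
Unset Strict Implicit.
Unset Printing Implicit Defensive.

Import Order.TTheory GRing.Theory Num.Theory.
Import numFieldNormedType.Exports.
Local Open Scope classical_set_scope.
Local Open Scope ring_scope.

Record virtual_tribracket (X : Type) (tri vir : X -> X -> X -> X) : Prop := {
  tri_div1 : forall b c d, exists! a, tri a b c = d;
  tri_div2 : forall a c d, exists! b, tri a b c = d;
  tri_div3 : forall a b d, exists! c, tri a b c = d;
  vir_div1 : forall b c d, exists! a, vir a b c = d;
  vir_div2 : forall a c d, exists! b, vir a b c = d;
  vir_div3 : forall a b d, exists! c, vir a b c = d;
  vir_invol : forall a b c, vir a (vir a b c) c = b;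
  tri_tri1 : forall a b c d,
    tri a b (tri b c d) = tri a (tri a b c) (tri (tri a b c) c d);
  tri_tri2 : forall a b c d,
    tri (tri a b c) c d = tri (tri a b (tri b c d)) (tri b c d) d;
  vir_vir1 : forall a b c d,
    vir a b (vir b c d) = vir a (vir a b c) (vir (vir a b c) c d);
  vir_vir2 : forall a b c d,
    vir (vir a b c) c d = vir (vir a b (vir b c d)) (vir b c d) d;
  tri_vir1 : forall a b c d,
    tri a b (vir b c d) = vir a (vir a b c) (tri (vir a b c) c d);
  tri_vir2 : forall a b c d,
    tri (vir a b c) c d = vir (tri a b (vir b c d)) (vir b c d) d }.

(* How a strand goes through a point: [Simple] means that the point is not a
   double point, the other values tell its role at the crossing. *)
Inductive passage := Simple | Over | Under | Virtual.

(* The role of the other strand at the same crossing. *)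
Definition swap (m : passage) : passage :=
  match m with Over => Under | Under => Over | _ => m end.

Definition det2 (R : realType) (u v : R * R) : R := u.1 * v.2 - u.2 * v.1.

(* A circle is the quotient of R by the period 1, and [0, 1[ is a set of
   representatives. *)
Definition circle (R : realType) : set R := [set t | 0 <= t < 1].

Definition meet (R : realType) (n : nat) (curve : 'I_n -> R -> R * R)
    (i : 'I_n) (s : R) (j : 'I_n) (t : R) : Prop :=
  [/\ circle s, circle t, (i, s) <> (j, t) & curve i s = curve j t].

(* Generic C^1 immersion of [ncomp] oriented circles, with marked crossings.
   [mark] is only meaningful for parameters in [circle]. *)
Record diagram (R : realType) := Diagram {
  ncomp : nat;
  curve : 'I_ncomp -> R -> R * R;
  mark : 'I_ncomp -> R -> passage;
  curve_periodic : forall i t, curve i (t + 1) = curve i t;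
  curve_derivable : forall i t, derivable (curve i) t 1;
  curve_C1 : forall i, continuous (derive1 (curve i));
  curve_immersed : forall i t, derive1 (curve i) t != 0;
  double_transverse : forall i s j t, meet curve i s j t ->
    det2 (derive1 (curve i) s) (derive1 (curve j) t) != 0;
  double_finite :
    finite_set [set p | exists i s j t, meet curve i s j t /\ p = curve i s];
  no_triple : forall i s j t k r,
    meet curve i s j t -> meet curve j t k r -> meet curve i s k r -> False;
  mark_simple : forall i s, circle s ->
    (mark i s <> Simple <-> exists j t, meet curve i s j t);
  mark_swap : forall i s j t, meet curve i s j t -> mark j t = swap (mark i s) }.

Definition trace (R : realType) (D : diagram R) : set (R * R) :=
  [set p | exists i t, circle t /\ curve (d := D) i t = p].

(* Some strand of [D] goes through [p] in the direction of [u] with role [m];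
   [u] is any positive multiple of the velocity, so that this does not depend
   on the parametrization of [D]. *)
Definition passes (R : realType) (D : diagram R) (p u : R * R) (m : passage) :
    Prop :=
  exists (i : 'I_(ncomp D)) (t c : R),
    [/\ circle t, curve i t = p, 0 < c,
        u = c *: derive1 (curve i) t & mark i t = m].

Definition is_region (R : realType) (D : diagram R) (A : set (R * R)) : Prop :=
  exists2 p, (~` trace D) p & A = connected_component (~` trace D) p.

Definition region (R : realType) (D : diagram R) : Type :=
  {A : set (R * R) | is_region D A}.

Definition region_at (R : realType) (D : diagram R) (p : R * R)
    (hp : (~` trace D) p) : region D :=
  exist (is_region D) (connected_component (~` trace D) p)
    (ex_intro2 _ _ p hp erefl).

(* The region containing the germ at [p] of the ray of direction [w]; used for
   [w] strictly inside one of the four sectors cut by the two tangent lines at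
   the crossing [p]. *)
Definition quadrant (R : realType) (D : diagram R) (p w : R * R)
    (A : region D) : Prop :=
  \forall e \near 0^'+, sval A (p + e *: w).

(* When [det2 u v > 0], facing the common direction [u + v], the strand [u]
   goes from back left to front right and [v] from back right to front left,
   so that [v - u] points to the left.  A classical crossing is positive when
   (over, under) is a direct basis, that is when [u] is over, and negative
   when [u] is under. *)
Definition coloring (R : realType) (X : Type) (tri vir : X -> X -> X -> X)
    (D : diagram R) (f : region D -> X) : Prop :=
  forall (p u v : R * R) (m : passage) (l r i o : region D),
    passes D p u m -> passes D p v (swap m) -> 0 < det2 u v ->
    quadrant p (v - u) l -> quadrant p (u - v) r ->
    quadrant p (- (u + v)) i -> quadrant p (u + v) o ->
    match m with
    | Over => tri (f l) (f i) (f r) = f o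
    | Under => tri (f l) (f o) (f r) = f i
    | Virtual => vir (f l) (f i) (f r) = f o
    | Simple => True
    end.

(* A picture drawn in the model disk [-1, 1]^2: strands [strand 0], ...,
   [strand nstrands.-1], parametrized by [-1, 1], with the roles of the strands at
   the points they go through. *)
Record tangle (R : realType) := Tangle {
  nstrands : nat;
  strand : nat -> R -> R * R;
  strand_mark : nat -> R -> passage }.

Definition cdisk (R : realType) : set (R * R) :=
  [set x | `|x.1| <= 1 /\ `|x.2| <= 1].
Definition odisk (R : realType) : set (R * R) :=
  [set x | `|x.1| < 1 /\ `|x.2| < 1].
Definition bdisk (R : realType) : set (R * R) := @cdisk R `\` @odisk R.

(* Analogue of [passes] in the open model disk, the strands [k] with [rev k]
   being run backwards. *)
Definition tangle_passes (R : realType) (T : tangle R) (rev : nat -> bool)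
    (x u : R * R) (m : passage) : Prop :=
  exists (k : nat) (t c : R),
    [/\ (k < nstrands T)%N /\ -1 < t < 1, strand T k t = x, 0 < c,
        u = ((-1) ^+ rev k * c) *: derive1 (strand T k) t & strand_mark T k t = m].

Definition tangle_end (R : realType) (T : tangle R) (x : R * R) : Prop :=
  exists2 k, (k < nstrands T)%N & x = strand T k (-1) \/ x = strand T k 1.

(* [psi] identifies the model disk with the closed disk [Delta]: it is a
   homeomorphism, and an orientation preserving diffeomorphism between the
   interiors; [phi] is the inverse.  Nothing more is asked at the boundary, so
   that [Delta] may be round, polygonal, etc. *)
Definition chart (R : realType) (Delta : set (R * R))
    (psi phi : R * R -> R * R) : Prop :=
  [/\ psi @` @cdisk R = Delta /\ psi @` @odisk R = interior Delta,
      {in @cdisk R, cancel psi phi},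
      {within @cdisk R, continuous psi},
      {within Delta, continuous phi} &
      forall x, odisk x ->
        [/\ differentiable psi x, differentiable phi (psi x) &
            0 < det2 ('d psi x (1, 0)) ('d psi x (0, 1))]].

(* In [Delta], the diagram [D] is the image by [psi] of the tangle [T]. *)
Definition draws (R : realType) (D : diagram R) (psi : R * R -> R * R)
    (T : tangle R) (rev : nat -> bool) : Prop :=
  [/\ forall x u m, odisk x ->
        (passes D (psi x) ('d psi x u) m <-> tangle_passes T rev x u m),
      forall x, bdisk x -> (trace D (psi x) <-> tangle_end T x) &
      forall x u m, bdisk x -> passes D (psi x) u m -> m = Simple].

(* Move I: an arc of parabola, and a nodal cubic with the same ends, which has
   one double point, the origin, reached at times -1/2 and 1/2. *)
Definition tangle_strand (R : realType) : tangle R :=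
  @Tangle R 1 (fun _ t => (t ^+ 2, t / 2)) (fun _ _ => Simple).

Definition tangle_kink (R : realType) (m : passage) : tangle R :=
  @Tangle R 1
    (fun _ t => ((4 * t ^+ 2 - 1) / 3, t * (4 * t ^+ 2 - 1) / 6))
    (fun _ t => if t == - (1 / 2) then m
                else if t == 1 / 2 then swap m else Simple).

(* Move II: two parallel lines, and two parabolas which cross at times -1/2
   and 1/2.  Strand 0 has the same role [m] at both crossings. *)
Definition tangle_parallel (R : realType) : tangle R :=
  @Tangle R 2 (fun k t => (t, (-1) ^+ k / 2)) (fun _ _ => Simple).

Definition tangle_bigon (R : realType) (m : passage) : tangle R :=
  @Tangle R 2
    (fun k t => (t, (-1) ^+ k * (4 * t ^+ 2 - 1) / 6))
    (fun k t => if (t == - (1 / 2)) || (t == 1 / 2)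
                then (if k == 0%N then m else swap m) else Simple).

(* Move III: strands 0 and 1 are lines crossing at the origin, and strand 2 is
   an arc of parabola passing above the origin if [e = 1], below if [e = -1];
   strand 2 crosses strand 0 at time e/2 and strand 1 at time -e/2.
   [role k l] is the role of strand [k] at its crossing with strand [l]. *)
Definition tangle_triangle (R : realType) (role : nat -> nat -> passage)
    (e : R) : tangle R :=
  @Tangle R 3
    (fun k t => (t, match k with
                    | 0%N => t / 2
                    | 1%N => - (t / 2)
                    | _ => e * (1 - t ^+ 2) / 3
                    end))
    (fun k t => match k with
                | 0%N => if t == 0 then role 0%N 1%N
                         else if t == e / 2 then role 0%N 2%N else Simple
                | 1%N => if t == 0 then role 1%N 0%N
                         else if t == - (e / 2) then role 1%N 2%N else Simple
                | _ => if t == e / 2 then role 2%N 0%N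
                       else if t == - (e / 2) then role 2%N 1%N else Simple
                end).

(* [h] gives the heights of the strands. *)
Definition classical_role (h : nat -> nat) (k l : nat) : passage :=
  if (h l < h k)%N then Over else Under.

(* The local moves, in one direction.  Roles [m] other than [Simple] are
   [Over], [Under] (classical moves) and [Virtual] (virtual moves). *)
Inductive local_move (R : realType) : tangle R -> tangle R -> Prop :=
| Move1 m : m <> Simple ->
    local_move (tangle_strand R) (tangle_kink R m)
| Move2 m : m <> Simple ->
    local_move (tangle_parallel R) (tangle_bigon R m)
| Move3_classical h : injective h ->
    local_move (tangle_triangle (classical_role h) 1)
               (tangle_triangle (classical_role h) (-1))
| Move3_virtual :
    local_move (tangle_triangle (fun _ _ => Virtual) 1)
               (tangle_triangle (fun _ _ => Virtual) (-1))
| Move3_mixed s h (role := fun k l =>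
      if (k == s) || (l == s) then Virtual else classical_role h k l) :
    (s < 3)%N -> injective h ->
    local_move (tangle_triangle role 1) (tangle_triangle role (-1)).

(* The identifications of [Delta] with the model disk used before and after the
   move agree on the boundary, but may differ by an isotopy inside. *)
Definition reidemeister (R : realType) (Delta : set (R * R))
    (D D' : diagram R) : Prop :=
  exists (T T' : tangle R) (rev : nat -> bool)
         (psi phi psi' phi' : R * R -> R * R),
    [/\ local_move T T' \/ local_move T' T,
        chart Delta psi phi /\ chart Delta psi' phi',
        forall x, bdisk x -> psi x = psi' x,
        draws D psi T rev /\ draws D' psi' T' rev &
        forall p u m, ~ Delta p -> (passes D p u m <-> passes D' p u m)].

Definition agree_outside (R : realType) (X : Type) (Delta : set (R * R))
    (D D' : diagram R) (f : region D -> X) (f' : region D' -> X) : Prop :=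
  forall p (hp : (~` trace D) p) (hp' : (~` trace D') p), ~ Delta p ->
    f' (region_at hp') = f (region_at hp).

(* Main.v *)
(* A coloring restricted to the disk [Delta] is the same thing as colors for
   the finitely many pieces cut out of the disk by the tangle, subject to one
   relation per crossing.  So each move amounts to an algebraic fact: colors of
   the pieces before the move determine unique colors of the pieces after it
   that agree along the boundary.  For moves I and II this is left, right and
   middle division.  For moves III, the axioms give the case where the strands
   all run from left to right in the standard order of heights; exchanging two
   neighbouring strands (by division, as with an auxiliary move II) and turning
   the hexagon of outer colors yield all other heights and orientations.

   Conversely, the colors of the pieces after the move and the old colors
   outside [Delta] form a locally constant function on the complement of the new
   diagram, hence a coloring of its regions.  No property of the plane beyond
   connectedness of convex sets is needed.  At a crossing, the chart is
   differentiable, so a ray in a quadrant of the diagram is the image of a curve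
   leaving the model crossing in the corresponding sector. *)
Require Import Defs.
From mathcomp Require Import all_boot all_order all_algebra.
From mathcomp Require Import all_classical all_reals all_analysis.
From mathcomp Require Import ring lra.

Set Implicit Arguments.
Unset Strict Implicit.
Unset Printing Implicit Defensive.

Import Order.TTheory GRing.Theory Num.Theory.
Import numFieldNormedType.Exports.
Local Open Scope classical_set_scope.
Local Open Scope ring_scope.

(** * Colors around crossings *)

(** The obstacle is the number of variants of move III: heights and directions multiply into dozens
    of cases. The colors at a crossing are therefore tied by a relation, [rel], rather than computed
    by an operation: which quadrant is the output depends on the directions, but a relation can be
    read from any quadrant, so that reversing a strand only permutes its arguments. Likewise [braid]
    compares two existence statements about the six outer colors, a form that survives turning the
    hexagon; uniqueness of the inner color comes separately, from division. On the topological side,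
    the boundary of [Delta] can be irregular and no arc of it is parametrized. The model pieces are
    open sets cut out by polynomial inequalities, an old and a new piece are matched as soon as they
    share one boundary point, and colors there are forced because every boundary point is a limit of
    points outside [Delta]. *)

Lemma swapK : involutive swap.
Proof. by case. Qed.

Lemma swap_neq_Simple m : m <> Simple -> swap m <> Simple.
Proof. by case: m. Qed.

Section CrossingRelation.
Variables (X : Type) (tri vir : X -> X -> X -> X).
Hypothesis HX : virtual_tribracket tri vir.

Definition std_rel (m : passage) (l i r o : X) : Prop :=
  match m with
  | Over => tri l i r = o
  | Under => tri l o r = i
  | Virtual => vir l i r = o
  | Simple => True
  end.

(* The relation between the colors of the quadrants of a crossing, named with
   respect to strands [k] and [l] with [det2 k l > 0], once [k] and [l] are
   reversed according to [rk] and [rl]; [m] is the role of [k]. *)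
Definition rel (m : passage) (rk rl : bool) (l i r o : X) : Prop :=
  match rk, rl with
  | false, false => std_rel m l i r o
  | true, true => std_rel m r o l i
  | true, false => std_rel (swap m) i r o l
  | false, true => std_rel (swap m) o l i r
  end.

Lemma vir_sym l i r o : vir l i r = o <-> vir l o r = i.
Proof. by split=> <-; rewrite (vir_invol HX). Qed.

(** Exchanging the incoming and outgoing sides swaps the roles. For classical crossings this is how
    [Over] and [Under] are read; for virtual ones it is [vir_invol]. It relates the two crossings of
    a bigon, where the strands come in opposite orders. *)
Lemma rel_flip m rk rl l i r o :
  rel (swap m) rl rk l o r i <-> rel m rk rl l i r o.
Proof. by case: m; case: rk; case: rl => //=; rewrite vir_sym. Qed.

(** A quarter turn: if [(k, l)] is a direct basis, so is [(-l, k)]. The next lemma uses [(l, -k)] in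
    the same way. *)
Lemma rel_rot m rk rl l i r o :
  rel m rk (~~ rl) l i r o <-> rel (swap m) rl rk o l i r.
Proof. by case: m; case: rk; case: rl. Qed.

Lemma rel_rotl m rk rl l i r o :
  rel m (~~ rk) rl l i r o <-> rel (swap m) rl rk i r o l.
Proof. by case: m; case: rk; case: rl. Qed.

Lemma std_rel_out m l i r : m <> Simple -> exists! o, std_rel m l i r o.
Proof.
case: m => //= _.
- by exists (tri l i r).
- exact: (tri_div2 HX).
- by exists (vir l i r).
Qed.

Lemma std_rel_left m i r o : m <> Simple -> exists! l, std_rel m l i r o.
Proof.
case: m => //= _; [exact: (tri_div1 HX)|exact: (tri_div1 HX)|].
exact: (vir_div1 HX).
Qed.

Lemma std_rel_right m l i o : m <> Simple -> exists! r, std_rel m l i r o.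
Proof.
case: m => //= _; [exact: (tri_div3 HX)|exact: (tri_div3 HX)|].
exact: (vir_div3 HX).
Qed.

Lemma std_rel_in m l r o : m <> Simple -> exists! i, std_rel m l i r o.
Proof.
case: m => //= _; [exact: (tri_div2 HX)| |exact: (vir_div2 HX)].
by exists (tri l o r).
Qed.

(** According to the reversals, [o] is the outgoing, left, right or incoming quadrant of the actual
    crossing, so every kind of division occurs. *)
Lemma rel_out m rk rl l i r : m <> Simple -> exists! o, rel m rk rl l i r o.
Proof.
move=> Hm; have Hs := swap_neq_Simple Hm.
by case: rk; case: rl => /=; [exact: std_rel_in|exact: std_rel_right|
  exact: std_rel_left|exact: std_rel_out].
Qed.

Lemma rel_in m rk rl l r o : m <> Simple -> exists! i, rel m rk rl l i r o.
Proof.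
move=> Hm; have Hs := swap_neq_Simple Hm.
have [i [Hi ui]] := rel_out rl rk l o r Hs.
exists i; split; first exact/rel_flip.
by move=> i' /rel_flip /ui.
Qed.

Lemma rel_left m rk rl i r o : m <> Simple -> exists! l, rel m rk rl l i r o.
Proof.
move=> Hm; have Hs := swap_neq_Simple Hm.
have [l [Hl ul]] := rel_out rl (~~ rk) i r o Hs.
exists l; split; first by rewrite -(negbK rk); apply/rel_rotl.
by move=> l'; rewrite -[in X in X -> _](negbK rk) => /rel_rotl /ul.
Qed.

(* The hexagon of colors of a Reidemeister move III, listed clockwise from the
   top as [a], [e], [g], [d], [c], [b]: [x] is the inner color before the move
   and [y] the inner color after it. *)
Definition braid (P Q S : X -> X -> X -> X -> Prop) : Prop :=
  forall a b c d e g,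
    (exists x, [/\ P a b c x, Q x c d g & S a x g e]) <->
    (exists y, [/\ S b c d y, Q a b y e & P e y d g]).

(** Either side computes its inner color, [e] and [g] from [a], [b], [c], [d]. The first equation
    says that the two values of [e] agree, the second one that the two values of [g] do. *)
Lemma braid_ops (p q s : X -> X -> X -> X) :
  (forall a b c d, q a b (s b c d) = s a (p a b c) (q (p a b c) c d)) ->
  (forall a b c d, q (p a b c) c d = p (q a b (s b c d)) (s b c d) d) ->
  braid (fun l i r o => p l i r = o) (fun l i r o => q l i r = o)
        (fun l i r o => s l i r = o).
Proof.
move=> E1 E2 a b c d e g; split.
  by case=> x [<- <- <-]; exists (s b c d); rewrite -E1 -E2.
by case=> y [<- <- <-]; exists (p a b c); rewrite -E2 -E1.
Qed.

(** * Move III under permutations and reversals of the strands *)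

Section Braid.
Variable role : nat -> nat -> passage.
Hypothesis role_swap : forall k l, k != l -> role l k = swap (role k l).
Hypothesis role_neq : forall k l, k != l -> role k l <> Simple.

Definition braid_role (A B C : nat) (u v w : bool) : Prop :=
  braid (rel (role A B) u v) (rel (role A C) u w) (rel (role B C) v w).

(* The divisions provide the color of the region that a move II between the
   first two strands would create. *)
Lemma braid_role_swap12 A B C u v w : A != B ->
  braid_role A B C u v w -> braid_role B A C v u w.
Proof.
move=> AB H a b c d e g; rewrite (role_swap AB).
have Hm := role_neq AB; split.
  move=> [x [/rel_flip Px Sx Qx]].
  (* The known hexagon is used with [x] and [y] as outer colors in place of [b] and [g], and with
     inner color [g] after the move. Its inner color [x'] before the move must be [b], since both
     complete the same crossing. *)
  have [y [Py _]] := rel_out u v e g d Hm.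
  have [|x' [Px' Qx' Sx']] := (H a x c d e y).2; first by exists g.
  have [z [_ uz]] := rel_out u v a x c Hm.
  have Eb : x' = b by rewrite -(uz _ Px) -(uz _ Px').
  by exists y; split; [rewrite -Eb|rewrite -Eb|exact/rel_flip].
move=> [y [Qy Sy /rel_flip Py]].
have [x [Px _]] := rel_in u v a c b Hm.
have [|y' [Sy' Qy' Py']] := (H a x c d e y).1; first by exists b.
have [z [_ uz]] := rel_in u v e d y Hm.
have Eg : y' = g by rewrite -(uz _ Py) -(uz _ Py').
by exists x; split; [exact/rel_flip|rewrite -Eg|rewrite -Eg].
Qed.

Lemma braid_role_swap23 A B C u v w : B != C ->
  braid_role A B C u v w -> braid_role A C B u w v.
Proof.
move=> BC H a b c d e g; rewrite (role_swap BC).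
have Hm := role_neq BC; split.
  move=> [x [Qx Px /rel_flip Sx]].
  have [y [Sy _]] := rel_in v w b d c Hm.
  have [|x' [Px' Qx' Sx']] := (H a b y d x g).2; first by exists c.
  have [z [_ uz]] := rel_in v w a g x Hm.
  have Ee : x' = e by rewrite -(uz _ Sx) -(uz _ Sx').
  by exists y; split; [exact/rel_flip|rewrite -Ee|rewrite -Ee].
move=> [y [/rel_flip Sy Py Qy]].
have [x [Sx _]] := rel_out v w a e g Hm.
have [|y' [Sy' Qy' Py']] := (H a b y d x g).1; first by exists e.
have [z [_ uz]] := rel_out v w b y d Hm.
have Ec : y' = c by rewrite -(uz _ Sy) -(uz _ Sy').
by exists x; split; [rewrite -Ec|rewrite -Ec|exact/rel_flip].
Qed.

(* A sixth of a turn of the hexagon takes the strands [A], [B], [C] to [B], [C]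
   and [A] reversed. *)
Lemma braid_role_turn A B C u v w : A != B -> A != C ->
  braid_role A B C u v w -> braid_role B C A v w (~~ u).
Proof.
move=> AB AC H a b c d e g.
have PE l i r o : rel (role B A) v (~~ u) l i r o <-> rel (role A B) u v o l i r.
  by rewrite rel_rot (role_swap AB) swapK.
have QE l i r o : rel (role C A) w (~~ u) l i r o <-> rel (role A C) u w o l i r.
  by rewrite rel_rot (role_swap AC) swapK.
split.
  move=> [x [Sx /PE Px /QE Qx]].
  (* The outer colors are shifted by one place. The turn also exchanges the triangles before and
     after the move, so [H] is read backwards. *)
  have [|y [Py Qy Sy]] := (H e a b c g d).2; first by exists x.
  by exists y; split; [exact/QE|exact/PE|].
move=> [y [/QE Qy /PE Py Sy]].
have [|x [Sx Qx Px]] := (H e a b c g d).1; first by exists y.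
by exists x; split; [|exact/PE|exact/QE].
Qed.

Definition braid_roles A B C : Prop := forall u v w, braid_role A B C u v w.

Lemma braid_roles_swap12 A B C : A != B ->
  braid_roles A B C -> braid_roles B A C.
Proof. by move=> AB H u v w; apply: braid_role_swap12. Qed.

Lemma braid_roles_swap23 A B C : B != C ->
  braid_roles A B C -> braid_roles A C B.
Proof. by move=> BC H u v w; apply: braid_role_swap23. Qed.

(* A strand is reversed by making it the first one, turning, and moving it
   back to its place. *)
Lemma braid_rolesW A B C : A != B -> A != C -> B != C ->
  braid_role A B C false false false -> braid_roles A B C.
Proof.
move=> AB AC BC H.
have flipA u v w : braid_role A B C u v w -> braid_role A B C (~~ u) v w.
  move=> /(braid_role_turn AB AC) K.
  by apply/braid_role_swap12; [rewrite eq_sym|apply: braid_role_swap23;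
    [rewrite eq_sym|exact: K]].
have flipC u v w : braid_role A B C u v w -> braid_role A B C u v (~~ w).
  move=> K; have CA : C != A by rewrite eq_sym.
  have CB : C != B by rewrite eq_sym.
  have {}K := braid_role_swap12 AC (braid_role_swap23 BC K).
  have {}K := braid_role_turn CA CB K.
  exact: K.
have flipB u v w : braid_role A B C u v w -> braid_role A B C u (~~ v) w.
  move=> /(braid_role_swap12 AB) K; have BA : B != A by rewrite eq_sym.
  have {}K := braid_role_turn BA BC K.
  apply: braid_role_swap23; first by rewrite eq_sym.
  exact: K.
move=> u v w.
have Hu : braid_role A B C u false false by case: u => //; apply: (flipA false).
have Hv : braid_role A B C u v false by case: v => //; apply: (flipB u false).
by case: w => //; apply: (flipC u v false).
Qed.

(** Exchanges of neighbouring strands generate all permutations of three strands, so it is enough to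
    know one order, with all strands running from left to right. *)
Lemma braid_roles_perm (A B C : nat) : A != B -> A != C -> B != C ->
  let P A B C := braid_role A B C false false false in
  P A B C \/ P A C B \/ P B A C \/ P B C A \/ P C A B \/ P C B A ->
  braid_roles A B C.
Proof.
move=> AB AC BC P.
have BA : B != A by rewrite eq_sym.
have CA : C != A by rewrite eq_sym.
have CB : C != B by rewrite eq_sym.
case=> [|[|[|[|[]]]]] /braid_rolesW H.
- exact: H.
- by apply: braid_roles_swap23 => //; apply: H.
- by apply: braid_roles_swap12 => //; apply: H.
- by apply: braid_roles_swap12 => //; apply: braid_roles_swap23 => //; apply: H.
- by apply: braid_roles_swap23 => //; apply: braid_roles_swap12 => //; apply: H.
- apply: braid_roles_swap12 => //; apply: braid_roles_swap23 => //.
  by apply: braid_roles_swap12 => //; apply: H.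
Qed.

Lemma braid_role_classical A B C :
  role A B = Over -> role A C = Over -> role B C = Over ->
  braid_role A B C false false false.
Proof.
move=> EAB EAC EBC; rewrite /braid_role EAB EAC EBC.
exact: (braid_ops (tri_tri1 HX) (tri_tri2 HX)).
Qed.

Lemma braid_role_virtual A B C :
  role A B = Virtual -> role A C = Virtual -> role B C = Virtual ->
  braid_role A B C false false false.
Proof.
move=> EAB EAC EBC; rewrite /braid_role EAB EAC EBC.
exact: (braid_ops (vir_vir1 HX) (vir_vir2 HX)).
Qed.

(** In the mixed axioms the virtual strand is the second one; the classical crossing is that of the
    first and third strands. *)
Lemma braid_role_mixed A B C :
  role A B = Virtual -> role A C = Over -> role B C = Virtual ->
  braid_role A B C false false false.
Proof.
move=> EAB EAC EBC; rewrite /braid_role EAB EAC EBC.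
exact: (braid_ops (tri_vir1 HX) (tri_vir2 HX)).
Qed.

End Braid.

Lemma classical_role_swap h k l : injective h -> k != l ->
  classical_role h l k = swap (classical_role h k l).
Proof.
move=> hI kl; rewrite /classical_role.
by case: ltngtP => // /hI E; rewrite E eqxx in kl.
Qed.

Lemma classical_role_neq h k l : classical_role h k l <> Simple.
Proof. by rewrite /classical_role; case: ifP. Qed.

(** The role that is bound locally in [Move3_mixed]. *)
Definition mixed_role h s k l :=
  if (k == s) || (l == s) then Virtual else classical_role h k l.

(** [1 2 0] is the order in which the strands of [tangle_triangle] start, from top to bottom on the
    left side of the disk. *)
Lemma braid_classical h : injective h -> braid_roles (classical_role h) 1 2 0.
Proof.
move=> hI; apply: braid_roles_perm => //.
- by move=> k l; apply: classical_role_swap.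
- by move=> k l _; apply: classical_role_neq.
have C A B C : (h C < h B)%N -> (h B < h A)%N ->
    braid_role (classical_role h) A B C false false false.
  move=> CB BA; apply: braid_role_classical; rewrite /classical_role ?CB ?BA //.
  by rewrite (ltn_trans CB BA).
(* Of the eight outcomes of the comparisons, two are cyclic and contradict transitivity; the others
   are the six orders of heights. *)
case: (ltngtP (h 0%N) (h 1%N)) => [h01|h10|/hI //];
case: (ltngtP (h 1%N) (h 2%N)) => [h12|h21|/hI //];
case: (ltngtP (h 0%N) (h 2%N)) => [h02|h20|/hI //];
try by [have := ltn_trans h01 h12; rewrite ltnNge (ltnW h20)
       |have := ltn_trans h21 h10; rewrite ltnNge (ltnW h02)].
- by do 2!right; left; apply: C.
- by left; apply: C.
- by right; left; apply: C.
- by do 3!right; left; apply: C.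
- by do 5!right; apply: C.
- by do 4!right; left; apply: C.
Qed.

Lemma braid_virtual : braid_roles (fun _ _ => Virtual) 1 2 0.
Proof. by apply: braid_rolesW => //; apply: braid_role_virtual. Qed.

Lemma mixed_role_swap h s k l : injective h -> k != l ->
  mixed_role h s l k = swap (mixed_role h s k l).
Proof.
move=> hI kl; rewrite /mixed_role orbC; case: ifP => // _.
exact: classical_role_swap.
Qed.

Lemma mixed_role_neq h s k l : mixed_role h s k l <> Simple.
Proof. by rewrite /mixed_role; case: ifP => // _; exact: classical_role_neq. Qed.

Lemma braid_mixed h s : injective h -> (s < 3)%N ->
  braid_roles (mixed_role h s) 1 2 0.
Proof.
move=> hI s3; apply: braid_roles_perm => //.
- by move=> k l; apply: mixed_role_swap.
- by move=> k l _; apply: mixed_role_neq.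
have M A C : A != s -> C != s -> (h C < h A)%N ->
    braid_role (mixed_role h s) A s C false false false.
  move=> As Cs CA; apply: braid_role_mixed; rewrite /mixed_role ?eqxx ?orbT //.
  by rewrite (negbTE As) (negbTE Cs) /= /classical_role CA.
case: s s3 M => [|[|[|//]]] _ M.
- case: (ltngtP (h 1%N) (h 2%N)) => [h12|h21|/hI //].
    by do 3!right; left; apply: M.
  by right; left; apply: M.
- case: (ltngtP (h 0%N) (h 2%N)) => [h02|h20|/hI //].
    by do 2!right; left; apply: M.
  by do 4!right; left; apply: M.
- case: (ltngtP (h 0%N) (h 1%N)) => [h01|h10|/hI //].
    by left; apply: M.
  by do 5!right; apply: M.
Qed.

End CrossingRelation.

(** * Regions and their colors *)

Section Joined.
Variable V : topologicalType.

Definition joined (S : set V) (x y : V) : Prop :=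
  exists C, [/\ connected C, C `<=` S, C x & C y].

Lemma joined_sym S x y : joined S x y -> joined S y x.
Proof. by move=> [C [? ? ? ?]]; exists C. Qed.

Lemma joined_trans S y x z : joined S x y -> joined S y z -> joined S x z.
Proof.
move=> [B [cB BS Bx By]] [C [cC CS Cy Cz]]; exists (B `|` C); split.
- by apply: connectedU => //; exists y.
- by rewrite subUset.
- by left.
- by right.
Qed.

Lemma joinedP S x y : joined S x y <-> connected_component S x y.
Proof.
by split=> [[C [? ? ? ?]]|[C [? ? ?] ?]]; exists C.
Qed.

End Joined.

Lemma joined_image (V W : topologicalType) (f : V -> W) (A S : set V)
    (S' : set W) (x y : V) :
  {within A, continuous f} -> S `<=` A -> f @` S `<=` S' ->
  joined S x y -> joined S' (f x) (f y).
Proof.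
move=> cf SA fS [C [cC CS Cx Cy]]; exists (f @` C); split.
- apply: connected_continuous_connected => //.
  by apply: continuous_subspaceW cf => z /CS /SA.
- by apply: subset_trans fS; apply: image_subset.
- by exists x.
- by exists y.
Qed.

Lemma joined_segment (R : realType) (V : normedModType R) (S : set V) (x y : V) :
  (forall t : R, 0 <= t <= 1 -> S (x + t *: (y - x))) -> joined S x y.
Proof.
move=> H; exists ((fun t : R => x + t *: (y - x)) @` `[0, 1]); split.
- apply: connected_continuous_connected; first exact: segment_connected.
  apply: continuous_subspaceT => t.
  by apply: cvgD; [exact: cvg_cst|apply: cvgZr_tmp; exact: cvg_id].
- by move=> _ [t + <-]; rewrite /= in_itv /= => /H.
- by exists 0; rewrite ?scale0r ?addr0 //= in_itv /= lexx ler01.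
- by exists 1; rewrite ?scale1r ?subrKC //= in_itv /= lexx ler01.
Qed.

Lemma joined_near (R : realType) (V : normedModType R) (S : set V) (x : V) :
  open S -> S x -> \forall y \near x, joined S x y.
Proof.
move=> oS Sx; have /nbhs_ballP [e e0 He] : nbhs x S by apply: open_nbhs_nbhs.
apply/nbhs_ballP; exists e => //= y xy; apply: joined_segment => t /andP[t0 t1].
apply: He; move: xy; rewrite -!ball_normE /= opprD addNKr normrN normrZ.
rewrite distrC => xy; apply: le_lt_trans xy.
by rewrite ger0_norm // ler_piMl.
Qed.

(** * Colors of points off the diagram *)

Section Colors.
Variables (R : realType) (X : Type).
Implicit Types (D : diagram R) (p q w : R * R).

Lemma curve_continuous D i : continuous (@curve R D i).
Proof.
move=> t; apply: differentiable_continuous; apply/derivable1_diffP.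
exact: curve_derivable.
Qed.

(** The set of representatives is half-open, but by periodicity the compact interval [[0, 1]] has
    the same image. *)
Lemma closed_trace D : closed (trace D).
Proof.
have -> : trace D = \bigcup_(i in [set: 'I_(ncomp D)]) (@curve R D i @` `[0, 1]).
  apply/seteqP; split=> [p [i [t [/andP[t0 t1] <-]]]|p [i _ [t]]].
    by exists i => //; exists t => //=; rewrite in_itv /= t0 ltW.
  rewrite /= in_itv /= => /andP[t0]; rewrite le_eqVlt => /predU1P[->|t1] <-.
    exists i, 0; split; first by rewrite /circle /= lexx ltr01.
    by rewrite -(curve_periodic i 0) add0r.
  by exists i, t; split=> //; rewrite /circle /= t0.
apply: closed_bigcup => [|i _]; first exact: finite_finset.
apply: compact_closed; first exact: norm_hausdorff.
apply: continuous_compact; last exact: segment_compact.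
by apply: continuous_subspaceT => t; apply: curve_continuous.
Qed.

(** As a relation between points and colors, it needs no proof that the point is off the trace, and
    it lets colorings of two diagrams be compared point by point. *)
Definition has_color D (f : region D -> X) q (z : X) : Prop :=
  exists2 A : region D, sval A q & f A = z.

Lemma region_eq D (A B : region D) q : sval A q -> sval B q -> A = B.
Proof.
case: A B => [A [a ha EA]] [B [b hb EB]] /= Aq Bq; apply: eq_exist.
rewrite EA EB in Aq Bq *.
by rewrite (same_connected_component Aq) (same_connected_component Bq).
Qed.

Lemma region_joined D (A : region D) p q :
  joined (~` trace D) p q -> sval A p -> sval A q.
Proof.
case: A => [A [a ha EA]] /= /joinedP pq; rewrite EA => ap.
exact: connected_component_trans ap pq.
Qed.

Lemma region_notin D (A : region D) p : sval A p -> ~ trace D p.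
Proof.
by case: A => [A [a ha EA]] /=; rewrite EA => /connected_component_sub.
Qed.

Lemma region_at_in D p (hp : (~` trace D) p) : sval (region_at hp) p.
Proof. exact: connected_component_refl. Qed.

Lemma has_color_fun D (f : region D -> X) q z z' :
  has_color f q z -> has_color f q z' -> z = z'.
Proof. by move=> [A Aq <-] [B Bq <-]; rewrite (region_eq Aq Bq). Qed.

Lemma has_color_notin D (f : region D -> X) q z :
  has_color f q z -> ~ trace D q.
Proof. by move=> [A /region_notin]. Qed.

Lemma has_color_at D (f : region D -> X) q (hq : (~` trace D) q) :
  has_color f q (f (region_at hq)).
Proof. by exists (region_at hq) => //; exact: region_at_in. Qed.

Lemma has_color_joined D (f : region D -> X) p q z :
  joined (~` trace D) p q -> has_color f p z -> has_color f q z.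
Proof. by move=> pq [A Ap <-]; exists A => //; exact: region_joined pq Ap. Qed.

Lemma has_color_near D (f : region D -> X) q z :
  has_color f q z -> \forall q' \near q, has_color f q' z.
Proof.
move=> Hq; have nq := has_color_notin Hq.
have := joined_near (closed_openC (closed_trace (D := D))) nq.
by apply: filterS => q' /has_color_joined; apply.
Qed.

Lemma agree_outsideP D D' (Delta : set (R * R)) (f : region D -> X)
    (f' : region D' -> X) :
  (forall q, ~ Delta q -> (trace D q <-> trace D' q)) ->
  agree_outside Delta f f' <->
  (forall q z, ~ Delta q -> (has_color f q z <-> has_color f' q z)).
Proof.
move=> E; split=> [H q z nq|H q hq hq' nq].
  split=> Hq; have hq := has_color_notin Hq; have hq' := hq.
    rewrite E // in hq'; rewrite -(has_color_fun (has_color_at f hq) Hq).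
    by rewrite -(H q hq hq') //; apply: has_color_at.
  rewrite -E // in hq'; rewrite -(has_color_fun (has_color_at f' hq) Hq).
  by rewrite (H q hq' hq) //; apply: has_color_at.
apply: has_color_fun (has_color_at f' hq') _.
by apply/H => //; apply: has_color_at.
Qed.

Lemma quadrant_color D (f : region D -> X) p w (A : region D) z :
  quadrant p w A -> (\forall e \near 0^'+, has_color f (p + e *: w) z) -> f A = z.
Proof.
move=> HA Hz; have [e [Ae he]] := filter_ex (filterI HA Hz).
by apply: has_color_fun he; exists A.
Qed.

(** An initial piece of the ray avoids the trace and is convex, so it stays in one region. *)
Lemma quadrant_ex D p w : (\forall e \near 0^'+, ~ trace D (p + e *: w)) ->
  exists A : region D, quadrant p w A.
Proof.
rewrite near_withinE => /nbhs_ballP [d /= d0 Hd].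
have H e : 0 < e -> e < d -> ~ trace D (p + e *: w).
  by move=> e0 ed; apply: Hd => //=; rewrite /ball /= sub0r normrN gtr0_norm.
have d2 : 0 < d / 2 by rewrite divr_gt0.
have dd : d / 2 < d by rewrite ltr_pdivrMr // ltr_pMr // ltr1n.
exists (region_at (H _ d2 dd)); rewrite /quadrant near_withinE.
apply/nbhs_ballP; exists d => //= e; rewrite /ball /= sub0r normrN => ed e0.
rewrite gtr0_norm // in ed.
apply: region_joined (region_at_in (H _ d2 dd)).
apply: joined_segment => t /andP[t0 t1].
have -> : p + (d / 2) *: w + t *: (p + e *: w - (p + (d / 2) *: w)) =
    p + (d / 2 + t * (e - d / 2)) *: w.
  by rewrite opprD addrACA subrr add0r -scalerBl scalerA -addrA -scalerDl.
by apply: H; nra.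
Qed.

End Colors.

(** * Charts *)

Section Chart.
Variable R : realType.
Implicit Types (x p u w : R * R).

Lemma det2Z (a b : R) (u v : R * R) : det2 (a *: u) (b *: v) = a * b * det2 u v.
Proof. by rewrite /det2 /= /GRing.scale /=; ring. Qed.

Lemma det2C (u v : R * R) : det2 v u = - det2 u v.
Proof. by rewrite /det2; ring. Qed.

Lemma det2_linear (L : {linear (R * R)%type -> (R * R)%type}) u v :
  det2 (L u) (L v) = det2 (L (1, 0)) (L (0, 1)) * det2 u v.
Proof.
have E w : L w = w.1 *: L (1, 0) + w.2 *: L (0, 1).
  rewrite -!linearZ -linearD; congr (L _).
  by apply: injective_projections; rewrite /GRing.scale /= /GRing.scale /=; ring.
rewrite (E u) (E v); move: (L _) (L _) => A B.
by rewrite /det2 /= /GRing.scale /=; ring.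
Qed.

Lemma linear_surj (L : {linear (R * R)%type -> (R * R)%type}) :
  0 < det2 (L (1, 0)) (L (0, 1)) -> forall u, exists v, u = L v.
Proof.
move=> d0 u; have [k dK] : exists k, k * det2 (L (1, 0)) (L (0, 1)) = 1.
  by exists (det2 (L (1, 0)) (L (0, 1)))^-1; rewrite mulVf // gt_eqF.
(* Cramer's rule. *)
exists ((k * det2 u (L (0, 1))) *: (1, 0) + (k * det2 (L (1, 0)) u) *: (0, 1)).
rewrite linearD !linearZ; move: (L (1, 0)) (L (0, 1)) dK => A B dK.
transitivity ((k * det2 A B) *: u); first by rewrite dK scale1r.
by apply: injective_projections;
  rewrite /GRing.scale /= /GRing.scale /= /det2; ring.
Qed.

Lemma odisk_cdisk : @odisk R `<=` @cdisk R.
Proof. by move=> x [/ltW ? /ltW ?]. Qed.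

Lemma cdisk_split x : cdisk x -> odisk x \/ bdisk x.
Proof. by move=> Hx; have [|] := pselect (odisk x); [left|right]. Qed.

Lemma cdiskE : @cdisk R = `[-1, 1] `*` `[-1, 1].
Proof.
by apply/seteqP; split=> x; rewrite /cdisk /= !in_itv /= !ler_norml;
  move=> [? ?].
Qed.

Lemma compact_cdisk : compact (@cdisk R).
Proof. by rewrite cdiskE; apply: compact_setX; exact: segment_compact. Qed.

Lemma open_odisk : open (@odisk R).
Proof.
have -> : @odisk R = fst @^-1` `]-1, 1[ `&` snd @^-1` `]-1, 1[.
  by apply/seteqP; split=> x; rewrite /odisk /= !in_itv /= !ltr_norml;
    move=> [? ?].
by apply: openI; apply: open_comp => [x _|];
  [exact: cvg_fst|exact: interval_open|exact: cvg_snd|exact: interval_open].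
Qed.

Variables (Delta : set (R * R)) (psi phi : R * R -> R * R).
Hypothesis H : chart Delta psi phi.

Lemma chart_closed : closed Delta.
Proof.
have [[<- _] _ cpsi _ _] := H; apply: compact_closed; first exact: norm_hausdorff.
by apply: continuous_compact; [|exact: compact_cdisk].
Qed.

Lemma chartK x : cdisk x -> phi (psi x) = x.
Proof. by have [_ K _ _ _] := H => Hx; rewrite K // inE. Qed.

Lemma chart_in x : cdisk x -> Delta (psi x).
Proof. by have [[<- _] _ _ _ _] := H; exists x. Qed.

Lemma chart_ex p : Delta p -> exists2 x, cdisk x & psi x = p.
Proof. by have [[<- _] _ _ _ _] := H; case=> x; exists x. Qed.

Lemma chart_inv p : Delta p -> cdisk (phi p) /\ psi (phi p) = p.
Proof. by move=> /chart_ex [x Hx <-]; rewrite chartK. Qed.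

Lemma chart_interior p : interior Delta p <-> exists2 x, odisk x & psi x = p.
Proof. by have [[_ <-] _ _ _ _] := H. Qed.

Lemma chart_boundary x : bdisk x -> ~ interior Delta (psi x).
Proof.
move=> [Hx nx] /chart_interior [y Hy /(congr1 phi)].
by rewrite !chartK //; [move=> E; apply: nx; rewrite -E|exact: odisk_cdisk].
Qed.

(** The chart is injective and the open disk fills the interior of [Delta], so a point of [bdisk] is
    not sent to the interior. This is how colors outside [Delta] determine those along its
    boundary. *)
Lemma chart_outside x : bdisk x -> forall P : set (R * R),
  nbhs (psi x) P -> exists2 q, ~ Delta q & P q.
Proof.
move=> Hx P HP; apply: contrapT => N; apply: (chart_boundary Hx).
apply: filterS HP => q Pq; apply: contrapT => nq; apply: N; by exists q.
Qed.

(** Chain rule: [phi \o psi] is the identity on a neighbourhood of the interior point [x]. *)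
Lemma chart_diffK x w : odisk x -> 'd phi (psi x) ('d psi x w) = w.
Proof.
move=> Hx; have [_ _ _ _ /(_ x Hx) [dpsi dphi _]] := H.
have E : 'd (phi \o psi) x w = 'd phi (psi x) ('d psi x w).
  exact: (congr1 (fun h : R * R -> R * R => h w) (diff_comp dpsi dphi)).
transitivity ('d (phi \o psi) x w); first by symmetry; exact: E.
rewrite -deriveE; last exact: differentiable_comp.
rewrite (@near_eq_derive _ _ _ _ id); first by rewrite derive_id.
have : nbhs x (@odisk R) by apply: open_nbhs_nbhs; split=> //; exact: open_odisk.
by apply: filterS => y /odisk_cdisk /chartK.
Qed.

Lemma chart_diff_surj x u : odisk x -> exists v, u = 'd psi x v.
Proof.
by move=> Hx; apply: linear_surj; have [_ _ _ _ /(_ x Hx) []] := H.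
Qed.

Lemma chart_diff_det x u v : odisk x ->
  (0 < det2 ('d psi x u) ('d psi x v)) = (0 < det2 u v).
Proof.
move=> Hx; rewrite det2_linear pmulr_rgt0 //.
by have [_ _ _ _ /(_ x Hx) []] := H.
Qed.

(* The germ of the set [P] at [x] contains all the curves leaving [x] in the
   direction of [w]. *)
Definition into (P : set (R * R)) x w : Prop :=
  forall a b : R -> R, a e @[e --> 0^'+] --> w.1 -> b e @[e --> 0^'+] --> w.2 ->
  \forall e \near 0^'+, P (x.1 + e * a e, x.2 + e * b e).

(** The straight ray at [psi x] pulls back under [phi] to a curve that leaves [x] with velocity [w],
    by [chart_diffK]. The functions [a] and [b] are the coordinates of its difference quotient. *)
Lemma chart_into (P : set (R * R)) x w : odisk x -> into P x w ->
  \forall e \near 0^'+, exists y, [/\ cdisk y, P y & psi y = psi x + e *: 'd psi x w].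
Proof.
move=> Hx HP; have [_ _ _ _ /(_ x Hx) [dpsi dphi _]] := H.
set p := psi x; set v := 'd psi x w.
have Hd : h^-1 *: (phi (h *: v + p) - x) @[h --> 0^'] --> w.
  have Dphi : derivable phi p v by apply: diff_derivable.
  have : 'D_v phi p = w by rewrite deriveE // chart_diffK.
  by move=> <-; move: (Dphi); rewrite /derivable /derive /= chartK //;
    apply: odisk_cdisk.
pose y e := phi (p + e *: v).
pose a e := e^-1 * ((y e).1 - x.1); pose b e := e^-1 * ((y e).2 - x.2).
have Hr : e^-1 *: (y e - x) @[e --> 0^'+] --> w.
  have -> : (fun e => e^-1 *: (y e - x)) =
      (fun h => h^-1 *: (phi (h *: v + p) - x)).
    by apply/funext => e; rewrite /y (addrC p).
  exact: (cvg_dnbhs_at_right Hd).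
have Ha : a e @[e --> 0^'+] --> w.1.
  exact: (cvg_comp _ fst Hr (@cvg_fst _ _ (nbhs w.1) (nbhs w.2) _)).
have Hb : b e @[e --> 0^'+] --> w.2.
  exact: (cvg_comp _ snd Hr (@cvg_snd _ _ (nbhs w.1) (nbhs w.2) _)).
have Hin : \forall e \near 0^'+, interior Delta (p + e *: v).
  have : p + e *: v @[e --> 0^'+] --> p.
    have : p + e *: v @[e --> (0 : R)] --> p + (0 : R) *: v.
      by apply: cvgD; [exact: cvg_cst|apply: cvgZr_tmp; exact: cvg_id].
    by rewrite scale0r addr0 => /cvg_at_right_filter.
  have N : nbhs p (interior Delta).
    apply: open_nbhs_nbhs; split; first exact: open_interior.
    by apply/chart_interior; exists x.
  by move=> /(_ _ N).
near=> e; exists (y e).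
have e0 : 0 < e by [].
have Dp : Delta (p + e *: v) by apply: interior_subset; near: e.
have [cy Ey] := chart_inv Dp; split=> //.
have -> : y e = (x.1 + e * a e, x.2 + e * b e).
  by rewrite /a /b !mulrA !divff ?gt_eqF // !mul1r !subrKC; case: (y e).
near: e; exact: HP.
Unshelve. all: by end_near. Qed.

End Chart.

(** * Tangles with their pieces and crossings *)

Section TangleModel.
Variable R : realType.

(** The quadrants are named for the strands as parametrized in the model, before any reversal;
    [crole] is the role of the first strand. *)
Record crossing (L : Type) := Crossing {
  cpoint : R * R;
  cstrand1 : nat;
  cstrand2 : nat;
  crole : passage;
  cdir1 : R * R;
  cdir2 : R * R;
  cleft : L;
  cin : L;
  cright : L;
  cout : L }.

(* The pieces [P j] are the components of the complement of the tangle in the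
   disk; only their traces on the disk matter. *)
Record tangle_model (T : tangle R) (L : Type) (P : L -> set (R * R))
    (base : L -> R * R) (cs : set (crossing L)) : Prop := {
  strand_odisk : forall k t, (k < nstrands T)%N -> -1 < t < 1 ->
    odisk (strand T k t);
  strand_bdisk : forall k, (k < nstrands T)%N ->
    bdisk (strand T k (-1)) /\ bdisk (strand T k 1);
  piece_open : forall j, open (P j);
  piece_disjoint : forall j j' x, cdisk x -> P j x -> P j' x -> j = j';
  piece_base : forall j, cdisk (base j) /\ P j (base j);
  piece_joined : forall j x, cdisk x -> P j x ->
    joined (P j `&` @cdisk R) (base j) x;
  piece_off : forall j k t, (k < nstrands T)%N -> -1 <= t <= 1 ->
    ~ P j (strand T k t);
  piece_cover : forall x, cdisk x -> (exists j, P j x) \/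
    exists k t, [/\ (k < nstrands T)%N, -1 <= t <= 1 & strand T k t = x];
  crossing_odisk : forall c, cs c -> odisk (cpoint c);
  crossing_role : forall c, cs c -> crole c <> Simple;
  crossing_det : forall c, cs c -> 0 < det2 (cdir1 c) (cdir2 c);
  crossing_pass1 : forall c, cs c -> exists t,
    [/\ (cstrand1 c < nstrands T)%N /\ -1 < t < 1, strand T (cstrand1 c) t = cpoint c,
        derive1 (strand T (cstrand1 c)) t = cdir1 c &
        strand_mark T (cstrand1 c) t = crole c];
  crossing_pass2 : forall c, cs c -> exists t,
    [/\ (cstrand2 c < nstrands T)%N /\ -1 < t < 1, strand T (cstrand2 c) t = cpoint c,
        derive1 (strand T (cstrand2 c)) t = cdir2 c &
        strand_mark T (cstrand2 c) t = swap (crole c)];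
  crossing_sectors : forall c a b, cs c -> 0 < a -> 0 < b ->
    [/\ into (P (cleft c)) (cpoint c) (b *: cdir2 c - a *: cdir1 c),
        into (P (cin c)) (cpoint c) (- (a *: cdir1 c + b *: cdir2 c)),
        into (P (cright c)) (cpoint c) (a *: cdir1 c - b *: cdir2 c) &
        into (P (cout c)) (cpoint c) (a *: cdir1 c + b *: cdir2 c)];
  crossing_only : forall c k t, cs c -> (k < nstrands T)%N -> -1 < t < 1 ->
    strand T k t = cpoint c ->
    [/\ k = cstrand1 c, derive1 (strand T k) t = cdir1 c & strand_mark T k t = crole c] \/
    [/\ k = cstrand2 c, derive1 (strand T k) t = cdir2 c &
        strand_mark T k t = swap (crole c)];
  crossing_mark : forall k t, (k < nstrands T)%N -> -1 < t < 1 ->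
    strand_mark T k t <> Simple -> exists2 c, cs c & strand T k t = cpoint c }.

(** * Colorings of a diagram inside the disk *)

Section Draw.
Variables (X : Type) (tri vir : X -> X -> X -> X).
Variables (T : tangle R) (L : Type) (P : L -> set (R * R)) (base : L -> R * R).
Variable cs : set (crossing L).
Hypothesis HT : tangle_model T P base cs.
Variable rev : nat -> bool.
Variables (Delta : set (R * R)) (psi phi : R * R -> R * R).
Hypothesis Hchart : chart Delta psi phi.
Variable D : diagram R.
Hypothesis Hdraws : draws D psi T rev.

Definition crossing_rel (col : L -> X) (c : crossing L) : Prop :=
  rel tri vir (crole c) (rev (cstrand1 c)) (rev (cstrand2 c))
    (col (cleft c)) (col (cin c)) (col (cright c)) (col (cout c)).

Definition coloring_at (f : region D -> X) (p : R * R) : Prop :=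
  forall (u v : R * R) (m : passage) (l r i o : region D),
    passes D p u m -> passes D p v (swap m) -> 0 < det2 u v ->
    quadrant p (v - u) l -> quadrant p (u - v) r ->
    quadrant p (- (u + v)) i -> quadrant p (u + v) o ->
    std_rel tri vir m (f l) (f i) (f r) (f o).

Definition piece_color (f : region D -> X) (col : L -> X) : Prop :=
  forall j x, cdisk x -> P j x -> has_color f (psi x) (col j).

Lemma trace_passes p : trace D p <-> exists u m, passes D p u m.
Proof.
split=> [[i [t [Ht <-]]]|[u [m [i [t [c [Ht Ep _ _ _]]]]]]]; last by exists i, t.
exists (1 *: derive1 (curve i) t), (mark i t), i, t, 1; split=> //.
Qed.

Lemma draw_trace x : cdisk x -> trace D (psi x) <->
  exists k t, [/\ (k < nstrands T)%N, -1 <= t <= 1 & strand T k t = x].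
Proof.
have [Hin Hbd _] := Hdraws; move=> /cdisk_split [Hx|Hx].
  rewrite trace_passes; split=> [[u [m]]|[k [t [kn /andP[t1 t2] E]]]].
    have [v ->] := chart_diff_surj Hchart u Hx; rewrite Hin //.
    move=> [k [t [c [[kn /andP[/ltW t1 /ltW t2]] E _ _ _]]]].
    by exists k, t; rewrite t1.
  (* At an end of the strand, [x] would be in [bdisk]. *)
  have Ht : -1 < t < 1.
    rewrite !lt_def t1 t2 !andbT; apply/andP; split; apply/eqP => Et.
      by case: (strand_bdisk HT kn) => -[_ + _]; rewrite -Et E; apply.
    by case: (strand_bdisk HT kn) => _ [_]; rewrite Et E; apply.
  exists ('d psi x (((-1) ^+ rev k * 1) *: derive1 (strand T k) t)), (strand_mark T k t).
  by apply/Hin => //; exists k, t, 1; split.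
rewrite Hbd //; split=> [[k kn [] ->]|[k [t [kn /andP[t1 t2] E]]]].
- by exists k, (-1); split=> //; apply/andP; split; lra.
- by exists k, 1; split=> //; apply/andP; split; lra.
exists k => //; have [|] := boolP (-1 < t < 1).
  by move=> /(strand_odisk HT kn); rewrite E; case: Hx.
rewrite negb_and -!leNgt => /orP[t3|t3]; [left|right]; rewrite -E; congr (strand T k _);
  by apply/eqP; rewrite eq_le ?t1 ?t2 ?t3.
Qed.

Lemma draw_piece x : cdisk x -> ~ trace D (psi x) <-> exists j, P j x.
Proof.
move=> Hx; rewrite draw_trace //; split=> [|[j Pj] [k [t [kn Ht E]]]].
  by case: (piece_cover HT Hx).
by rewrite -E in Pj; exact: (piece_off HT kn Ht Pj).
Qed.

Lemma piece_joined_psi j x y : cdisk x -> P j x -> cdisk y -> P j y ->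
  joined (~` trace D) (psi x) (psi y).
Proof.
move=> cx Px cy Py; have [_ _ cpsi _ _] := Hchart.
apply: (joined_image (S := P j `&` @cdisk R) cpsi); first by move=> z [].
  by move=> _ [z [Pz cz] <-]; apply/draw_piece => //; exists j.
by apply: joined_trans (piece_joined HT cy Py); apply/joined_sym/(piece_joined HT).
Qed.

Lemma piece_color_ex f : exists col, piece_color f col.
Proof.
have B j : ~ trace D (psi (base j)).
  by have [cb Pb] := piece_base HT j; apply/draw_piece => //; exists j.
exists (fun j => f (region_at (B j))) => j x cx Px.
have [cb Pb] := piece_base HT j.
exact: has_color_joined (piece_joined_psi cb Pb cx Px) (has_color_at f (B j)).
Qed.

Section Color.
Variables (f : region D -> X) (col : L -> X).
Hypothesis Hcol : piece_color f col.

Lemma sector_ray x w j : odisk x -> into (P j) x w ->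
  \forall e \near 0^'+, has_color f (psi x + e *: 'd psi x w) (col j).
Proof.
move=> Hx /(chart_into Hchart Hx); apply: filterS => e [y [cy Py <-]].
exact: Hcol.
Qed.

Lemma sector_color x w j (A : region D) : odisk x -> into (P j) x w ->
  quadrant (psi x) ('d psi x w) A -> f A = col j.
Proof. by move=> Hx HP HA; apply: quadrant_color HA (sector_ray Hx HP). Qed.

Lemma sector_ex x w j : odisk x -> into (P j) x w ->
  exists A : region D, quadrant (psi x) ('d psi x w) A.
Proof.
move=> Hx /(sector_ray Hx) HP; apply: quadrant_ex.
by apply: filterS HP => e; apply: has_color_notin.
Qed.

(* [u] and [v] are the directions of the strands at the crossing [c], in the
   order which makes [det2 u v] positive, as in the definition of [coloring]. *)
Record oriented (c : crossing L) (u v : R * R) (m : passage) (jl ji jr jo : L) :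
    Prop := {
  oriented_det : 0 < det2 u v;
  oriented_left : into (P jl) (cpoint c) (v - u);
  oriented_right : into (P jr) (cpoint c) (u - v);
  oriented_in : into (P ji) (cpoint c) (- (u + v));
  oriented_out : into (P jo) (cpoint c) (u + v);
  oriented_rel : crossing_rel col c <->
    std_rel tri vir m (col jl) (col ji) (col jr) (col jo) }.

(** Changing the sign of one vector exchanges sum and difference up to sign, so reversals permute
    the four sectors. If exactly one strand is reversed, the two must also be exchanged to keep a
    direct basis. The factors [a] and [b] are independent because [passes] allows any positive
    multiple of a velocity. *)
Lemma crossing_oriented c a b : cs c -> 0 < a -> 0 < b ->
  let u := ((-1) ^+ rev (cstrand1 c) * a) *: cdir1 c in
  let v := ((-1) ^+ rev (cstrand2 c) * b) *: cdir2 c in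
  match rev (cstrand1 c), rev (cstrand2 c) with
  | false, false =>
      oriented c u v (crole c) (cleft c) (cin c) (cright c) (cout c)
  | true, true =>
      oriented c u v (crole c) (cright c) (cout c) (cleft c) (cin c)
  | true, false =>
      oriented c v u (swap (crole c)) (cin c) (cright c) (cout c) (cleft c)
  | false, true =>
      oriented c v u (swap (crole c)) (cout c) (cleft c) (cin c) (cright c)
  end.
Proof.
move=> Hc a0 b0 u v; have d0 := crossing_det HT Hc.
have [Il Ii Ir Io] := crossing_sectors HT Hc a0 b0.
have dAB : 0 < det2 (a *: cdir1 c) (b *: cdir2 c) by rewrite det2Z !mulr_gt0.
rewrite opprD in Ii; rewrite {}/u {}/v.
case E1: (rev (cstrand1 c)); case E2: (rev (cstrand2 c));
  rewrite ?expr1 ?expr0 ?mul1r ?mulN1r ?scaleNr;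
  (split; last by rewrite /crossing_rel E1 E2);
  rewrite ?opprD ?opprK //.
all: try by rewrite addrC.
all: move: (a *: cdir1 c) (b *: cdir2 c) dAB => A B dAB.
all: by apply: etrans dAB; congr (0 < _); rewrite /det2 /=; ring.
Qed.

Lemma std_rel_sectors x u v m jl ji jr jo : odisk x ->
  coloring_at f (psi x) ->
  tangle_passes T rev x u m -> tangle_passes T rev x v (swap m) ->
  0 < det2 u v ->
  into (P jl) x (v - u) -> into (P jr) x (u - v) ->
  into (P ji) x (- (u + v)) -> into (P jo) x (u + v) ->
  std_rel tri vir m (col jl) (col ji) (col jr) (col jo).
Proof.
move=> Hx Hf Pu Pv d0 Il Ir Ii Io; have [Hin _ _] := Hdraws.
have [Al Hl] := sector_ex Hx Il; have [Ar Hr] := sector_ex Hx Ir.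
have [Ai Hi] := sector_ex Hx Ii; have [Ao Ho] := sector_ex Hx Io.
rewrite -(sector_color Hx Il Hl) -(sector_color Hx Ir Hr).
rewrite -(sector_color Hx Ii Hi) -(sector_color Hx Io Ho).
apply: (Hf ('d psi x u) ('d psi x v)).
- exact/Hin.
- exact/Hin.
- by rewrite (chart_diff_det Hchart).
- by rewrite -linearB.
- by rewrite -linearB.
- by rewrite -linearD -linearN.
- by rewrite -linearD.
Qed.

Lemma coloring_crossing c : coloring_at f (psi (cpoint c)) -> cs c ->
  crossing_rel col c.
Proof.
move=> Hf Hc; have Hx := crossing_odisk HT Hc.
have [t1 [[k1 Ht1] Et1 Ed1 Em1]] := crossing_pass1 HT Hc.
have [t2 [[k2 Ht2] Et2 Ed2 Em2]] := crossing_pass2 HT Hc.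
have P1 : tangle_passes T rev (cpoint c)
    (((-1) ^+ rev (cstrand1 c) * 1) *: cdir1 c) (crole c).
  by exists (cstrand1 c), t1, 1; split=> //; rewrite Ed1.
have P2 : tangle_passes T rev (cpoint c)
    (((-1) ^+ rev (cstrand2 c) * 1) *: cdir2 c) (swap (crole c)).
  by exists (cstrand2 c), t2, 1; split=> //; rewrite Ed2.
have := crossing_oriented Hc ltr01 ltr01.
case: (rev (cstrand1 c)) P1; case: (rev (cstrand2 c)) P2 => P2 P1 /=
  [d0 Il Ir Ii Io ->];
  by apply: (std_rel_sectors Hx Hf) d0 Il Ir Ii Io => //; rewrite swapK.
Qed.

Lemma crossing_coloring p : Delta p -> (forall c, cs c -> crossing_rel col c) ->
  coloring_at f p.
Proof.
move=> /(chart_ex Hchart) [x cx <-] Hc u v m l r i o Pu Pv d0 Ql Qr Qi Qo.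
have [Hin _ Hbd] := Hdraws; case: (cdisk_split cx) => Hx; last first.
  by rewrite (Hbd _ _ _ Hx Pu).
have [Em|nm] := pselect (m = Simple); first by rewrite Em.
have [u0 Eu] := chart_diff_surj Hchart u Hx.
have [v0 Ev] := chart_diff_surj Hchart v Hx; subst u v.
rewrite (chart_diff_det Hchart) // in d0.
rewrite -!linearB in Ql Qr; rewrite -!linearD -?linearN in Qi Qo.
move: Pu Pv; rewrite !Hin // => -[k [t [a [[kn Ht] Et a0 Eu Em]]]].
move=> [k' [t' [b [[kn' Ht'] Et' b0 Ev Em']]]].
have [|c Hcs Ec] := crossing_mark HT kn Ht; first by rewrite Em.
have Exc : x = cpoint c by rewrite -Et.
have S jl ji jr jo : oriented c u0 v0 m jl ji jr jo ->
    std_rel tri vir m (f l) (f i) (f r) (f o).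
  move=> [_ Il Ir Ii Io E]; rewrite -Exc in Il Ir Ii Io.
  rewrite (sector_color Hx Il Ql) (sector_color Hx Ir Qr).
  rewrite (sector_color Hx Ii Qi) (sector_color Hx Io Qo).
  exact/E/Hc.
have N m' jl ji jr jo : oriented c v0 u0 m' jl ji jr jo -> False.
  by move=> [+ _ _ _ _ _]; rewrite det2C oppr_gt0 ltNge ltW.
have det_same (x1 x2 : R) w : det2 (x1 *: w) (x2 *: w) = 0.
  by rewrite det2Z /det2; ring.
have Exc' : strand T k' t' = cpoint c by rewrite Et'.
(* Two passages along the same branch have determinant zero. Along different branches, the sign of
   the determinant selects the order given by [crossing_oriented]. *)
case: (crossing_only HT Hcs kn Ht Ec) => -[Ek Ed Er];
case: (crossing_only HT Hcs kn' Ht' Exc') => -[Ek' Ed' Er'].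
- by rewrite Eu Ev Ed Ed' det_same ltxx in d0.
- have Hu : u0 = ((-1) ^+ rev (cstrand1 c) * a) *: cdir1 c by rewrite Eu Ed Ek.
  have Hv : v0 = ((-1) ^+ rev (cstrand2 c) * b) *: cdir2 c by rewrite Ev Ed' Ek'.
  have := crossing_oriented Hcs a0 b0; rewrite /= -Hu -Hv -Er Em.
  by case: (rev (cstrand1 c)); case: (rev (cstrand2 c));
    move=> O; first [case: (N _ _ _ _ _ O)|apply: S O].
- have Hu : u0 = ((-1) ^+ rev (cstrand2 c) * a) *: cdir2 c by rewrite Eu Ed Ek.
  have Hv : v0 = ((-1) ^+ rev (cstrand1 c) * b) *: cdir1 c by rewrite Ev Ed' Ek'.
  have := crossing_oriented Hcs b0 a0; rewrite /= -Hu -Hv -Er Em.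
  by case: (rev (cstrand1 c)); case: (rev (cstrand2 c));
    move=> O; first [case: (N _ _ _ _ _ O)|apply: S O].
- by rewrite Eu Ev Ed Ed' det_same ltxx in d0.
Qed.

End Color.
End Draw.
End TangleModel.

(** * Transfer of a coloring through a move *)

Section Transfer.
Variables (R : realType) (X : Type) (tri vir : X -> X -> X -> X).

Lemma chart_near (Delta : set (R * R)) psi phi (Q : set (R * R)) q :
  chart Delta psi phi -> open Q -> Delta q -> Q (phi q) ->
  \forall q' \near q, Delta q' -> Q (phi q').
Proof.
move=> [_ _ _ /subspace_continuousP cphi _] oQ Dq Qq.
by apply: (cphi q Dq); apply: open_nbhs_nbhs.
Qed.

Lemma near_ray (S : set (R * R)) (p w : R * R) : nbhs p S ->
  \forall e \near 0^'+, S (p + e *: w).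
Proof.
move=> N; have : p + e *: w @[e --> (0 : R)] --> p + (0 : R) *: w.
  by apply: cvgD; [exact: cvg_cst|apply: cvgZr_tmp; exact: cvg_id].
by rewrite scale0r addr0 => /cvg_at_right_filter /(_ _ N).
Qed.

Lemma coloring_at_outside (Delta : set (R * R)) (D D' : diagram R)
    (f : region D -> X) (f' : region D' -> X) p :
  closed Delta -> ~ Delta p ->
  (forall u m, passes D p u m <-> passes D' p u m) ->
  (forall q z, ~ Delta q -> (has_color f q z <-> has_color f' q z)) ->
  coloring_at tri vir f p -> coloring_at tri vir f' p.
Proof.
move=> cD np Hpass Hcol Hf u v m l r i o /Hpass Pu /Hpass Pv d0 Ql Qr Qi Qo.
have Q w (A' : region D') : quadrant p w A' ->
    exists2 A : region D, quadrant p w A & f A = f' A'.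
  move=> HA'; have Hray : \forall e \near 0^'+, has_color f (p + e *: w) (f' A').
    have nD : nbhs p (~` Delta).
      by apply: open_nbhs_nbhs; split=> //; exact: closed_openC.
    apply: filterS2 (near_ray w nD) HA' => e ne Ae.
    by apply/Hcol => //; exists A'.
  have [|A HA] := @quadrant_ex _ D p w.
    by apply: filterS Hray => e; apply: has_color_notin.
  by exists A => //; apply: quadrant_color HA Hray.
have [Al Hl <-] := Q _ _ Ql; have [Ar Hr <-] := Q _ _ Qr.
have [Ai Hi <-] := Q _ _ Qi; have [Ao Ho <-] := Q _ _ Qo.
exact: Hf Pu Pv d0 Hl Hr Hi Ho.
Qed.

Variables (T T' : tangle R) (L L' : Type).
Variables (P : L -> set (R * R)) (base : L -> R * R) (cs : set (crossing R L)).
Variables (P' : L' -> set (R * R)) (base' : L' -> R * R)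
  (cs' : set (crossing R L')).
Hypotheses (HT : tangle_model T P base cs) (HT' : tangle_model T' P' base' cs').
Variable rev : nat -> bool.

(* [arcs j j'] holds when the pieces [j] and [j'] share an arc of the boundary
   of the disk. *)
Variable arcs : L -> L' -> Prop.
Hypothesis arcsP : forall j j',
  arcs j j' <-> exists x, [/\ bdisk x, P j x & P' j' x].
Hypothesis arcs_ends : forall x, bdisk x ->
  (exists j, P j x) <-> (exists j', P' j' x).
Hypothesis colors_ex : forall col : L -> X,
  (forall c, cs c -> crossing_rel tri vir rev col c) ->
  exists col' : L' -> X, (forall c, cs' c -> crossing_rel tri vir rev col' c) /\
    forall j j', arcs j j' -> col j = col' j'.
Hypothesis colors_unique : forall col1 col2 : L' -> X,
  (forall c, cs' c -> crossing_rel tri vir rev col1 c) ->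
  (forall c, cs' c -> crossing_rel tri vir rev col2 c) ->
  (forall j j', arcs j j' -> col1 j' = col2 j') -> forall j', col1 j' = col2 j'.

Variables (Delta : set (R * R)) (psi phi psi' phi' : R * R -> R * R).
Hypotheses (Hchart : chart Delta psi phi) (Hchart' : chart Delta psi' phi').
Hypothesis Hpsi : forall x, bdisk x -> psi x = psi' x.
Variables (D D' : diagram R).
Hypotheses (HD : draws D psi T rev) (HD' : draws D' psi' T' rev).
Hypothesis Hout : forall p u m, ~ Delta p -> (passes D p u m <-> passes D' p u m).
Variable f : region D -> X.
Hypothesis Hf : coloring tri vir f.

Lemma trace_outside q : ~ Delta q -> (trace D q <-> trace D' q).
Proof.
move=> nq; rewrite !trace_passes; split=> -[u [m Pq]]; exists u, m;
  exact/(Hout _ _ nq).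
Qed.

Section Extend.
Variables (col : L -> X) (col' : L' -> X).
Hypothesis Hcol : piece_color P psi f col.
Hypothesis Hcol' : forall j j', arcs j j' -> col j = col' j'.

(** Boundary points of [Delta] are colored from inside. It is a relation because a function on
    regions is available only once the colors are known to be constant on them. *)
Definition new_color (q : R * R) (z : X) : Prop :=
  (~ Delta q /\ has_color f q z) \/
  exists x j', [/\ cdisk x, P' j' x, psi' x = q & col' j' = z].

Lemma new_color_fun q z z' : new_color q z -> new_color q z' -> z = z'.
Proof.
move=> [[nq Hq]|[x [j [cx Px Ex <-]]]] [[nq' Hq']|[y [k [cy Py Ey <-]]]].
- exact: has_color_fun Hq Hq'.
- by case: nq; rewrite -Ey; exact: (chart_in Hchart').
- by case: nq'; rewrite -Ex; exact: (chart_in Hchart').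
- have Exy : x = y by rewrite -(chartK Hchart' cx) Ex -Ey (chartK Hchart').
  by rewrite Exy in Px; rewrite (piece_disjoint HT' cy Px Py).
Qed.

Lemma new_color_ex q : ~ trace D' q -> exists z, new_color q z.
Proof.
move=> Tq; have [Dq|nq] := pselect (Delta q); last first.
  have Tq' : ~ trace D q by rewrite trace_outside.
  by exists (f (region_at Tq')); left; split=> //; exact: has_color_at.
have [x cx Ex] := chart_ex Hchart' Dq; rewrite -Ex in Tq *.
have [j Pj] := (draw_piece HT' Hchart' HD' cx).1 Tq.
by exists (col' j); right; exists x, j.
Qed.

(* The new colors are locally constant off the new diagram, also at the points
   of the boundary of [Delta], hence they are constant on its regions. *)
Lemma new_color_near q z : new_color q z ->
  \forall q' \near q, ~ trace D' q' -> new_color q' z.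
Proof.
case=> [[nq Hq]|[x [j' [cx Px Ex Ez]]]].
  have nD : nbhs q (~` Delta).
    apply: open_nbhs_nbhs; split=> //; apply: closed_openC.
    exact: chart_closed Hchart.
  by apply: filterS2 nD (has_color_near Hq) => q' nq' Hq' _; left.
have Dq : Delta q by rewrite -Ex; exact: (chart_in Hchart').
have Pq : P' j' (phi' q) by rewrite -Ex (chartK Hchart').
have oP : open (P' j') by exact: (piece_open HT').
have Hin := chart_near Hchart' oP Dq Pq.
(* Near an interior point of [Delta] there is nothing outside. At a boundary point the old and new
   pieces share an arc, so the old color of [q] is already [z], and it persists nearby. *)
have Hex : \forall q' \near q, ~ Delta q' -> has_color f q' z.
  case: (cdisk_split cx) => Hx.
    have : interior Delta q by apply/(chart_interior Hchart'); exists x.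
    by apply: filterS => q' Dq' nq'.
  have [j Pj] : exists j, P j x by apply/arcs_ends => //; exists j'.
  have : has_color f q z.
    rewrite -Ex -Hpsi // -Ez -(Hcol' (j := j)); first exact: Hcol.
    by apply/arcsP; exists x.
  by move=> Hq; apply: filterS (has_color_near Hq) => q' Hq' _.
apply: filterS2 Hin Hex => q' Hq' Hq'' _.
have [Dq'|nq'] := pselect (Delta q'); last by left; split=> //; exact: Hq''.
have [cq Eq] := chart_inv Hchart' Dq'.
by right; exists (phi' q'), j'; split=> //; apply: Hq'.
Qed.

(** The points of [C] with color [z] are open and closed in [C]: open since [z] persists nearby,
    closed since every other color does too. *)
Lemma new_color_connected (C : set (R * R)) q1 q2 z :
  connected C -> C `<=` ~` trace D' -> C q1 -> C q2 ->
  new_color q1 z -> new_color q2 z.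
Proof.
move=> cC CT C1 C2 H1.
pose B := C `&` [set q | new_color q z].
suff E : B = C by have [] : B q2 by rewrite E.
apply: cC; first by exists q1.
- exists (interior [set q | ~ trace D' q -> new_color q z]).
    exact: open_interior.
  apply/seteqP; split=> q [Cq Hq]; split=> //; first exact: new_color_near.
  exact: (nbhs_singleton Hq) (CT _ Cq).
- exists (~` interior [set q | ~ trace D' q -> ~ new_color q z]).
    by apply: open_closedC; exact: open_interior.
  apply/seteqP; split=> q [Cq Hq]; split=> //.
    by move=> /nbhs_singleton; apply => //; exact: CT.
  have [z0 Hz0] := new_color_ex (CT _ Cq).
  have [<- //|nz] := pselect (z0 = z).
  exfalso; apply: Hq; apply: filterS (new_color_near Hz0) => q' + Tq' Hq'.
  by move=> /(_ Tq') /new_color_fun /(_ Hq') /nz.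
Qed.

Lemma new_coloring_ex :
  exists f' : region D' -> X, forall q z, ~ trace D' q ->
    (has_color f' q z <-> new_color q z).
Proof.
have E (A : region D') : exists z, forall q, sval A q -> new_color q z.
  case: A => [A [p Tp EA]] /=; have [z Hz] := new_color_ex Tp.
  exists z => q; rewrite EA => Aq.
  exact: (new_color_connected (@component_connected _ (~` trace D') p)
    (@connected_component_sub _ _ p) (connected_component_refl Tp) Aq Hz).
exists (fun A => sval (cid (E A))) => q z Tq; split=> [[A Aq <-]|Hz].
  by case: cid => z' /= Hz'; exact: Hz'.
exists (region_at Tq); first exact: region_at_in.
case: cid => z' /= /(_ q (region_at_in Tq)) Hz'.
exact: new_color_fun Hz' Hz.
Qed.

End Extend.

Lemma transfer_coloring : exists! f' : region D' -> X,
  coloring tri vir f' /\ agree_outside Delta f f'.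
Proof.
have [col Hcol] := piece_color_ex HT Hchart HD f.
have Hrel c : cs c -> crossing_rel tri vir rev col c.
  by move=> Hc; apply: (coloring_crossing HT Hchart HD Hcol _ Hc); exact: Hf.
have [col' [Hrel' Harc]] := colors_ex Hrel.
have [f' Hf'] := new_coloring_ex Hcol Harc.
have Hagree q z : ~ Delta q -> (has_color f q z <-> has_color f' q z).
  move=> nq; split=> Hq.
    have Tq : ~ trace D' q by rewrite -trace_outside //; exact: has_color_notin Hq.
    by apply/Hf' => //; left.
  move: (Hq) => /Hf' -/(_ (has_color_notin Hq)) [[] //|[x [j [cx _ Ex _]]]].
  by case: nq; rewrite -Ex; exact: (chart_in Hchart').
have Hpiece : piece_color P' psi' f' col'.
  move=> j x cx Px; apply/Hf'; last by right; exists x, j.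
  by apply/(draw_piece HT' Hchart' HD') => //; exists j.
exists f'; split.
  split; last exact/(agree_outsideP _ _ trace_outside).
  suff : forall p, coloring_at tri vir f' p by [].
  move=> p; have [Dp|np] := pselect (Delta p).
    exact: (crossing_coloring HT' Hchart' HD' Hpiece).
  apply: (coloring_at_outside (chart_closed Hchart) np _ Hagree); last exact: Hf.
  by move=> u m; apply: Hout.
move=> g [Hg /(agree_outsideP _ _ trace_outside) Gagree].
have [gcol Hgcol] := piece_color_ex HT' Hchart' HD' g.
have Hgrel c : cs' c -> crossing_rel tri vir rev gcol c.
  by move=> Hc; apply: (coloring_crossing HT' Hchart' HD' Hgcol _ Hc); exact: Hg.
(* Any extension is forced along the boundary: near a boundary point there is a point outside
   [Delta] at which both the old and the new piece colors are read. *)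
have Ebd (h : region D' -> X) hcol j j' : piece_color P' psi' h hcol ->
    (forall q z, ~ Delta q -> (has_color f q z <-> has_color h q z)) ->
    arcs j j' -> hcol j' = col j.
  move=> Hh Hfh /arcsP [x [Hx Pj Pj']]; have cx := Hx.1.
  have Hq := Hh _ _ cx Pj'; rewrite -Hpsi // in Hq.
  have [q nq [H1 H2]] := chart_outside Hchart Hx
    (filterI (has_color_near (Hcol _ _ cx Pj)) (has_color_near Hq)).
  by apply: has_color_fun H2 _; apply/Hfh.
have Ecol j' : col' j' = gcol j'.
  apply: colors_unique => // j {}j' Hj.
  by rewrite (Ebd f' col' j) // (Ebd g gcol j).
apply/funext => A; have [p Ap] : exists p, sval A p.
  case: A => [A [p Tp EA]] /=; exists p; rewrite EA.
  exact: connected_component_refl.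
have Tp := region_notin Ap; have [Dp|np] := pselect (Delta p); last first.
  apply: (@has_color_fun _ _ _ g p); last by exists A.
  by apply/Gagree => //; apply/Hagree => //; exists A.
have [x cx Ex] := chart_ex Hchart' Dp; rewrite -Ex in Tp Ap.
have [j Pj] := (draw_piece HT' Hchart' HD' cx).1 Tp.
have -> : f' A = col' j by apply: has_color_fun (Hpiece _ _ cx Pj); exists A.
by rewrite Ecol; apply: has_color_fun (Hgcol _ _ cx Pj) _; exists A.
Qed.

End Transfer.

Definition colorings_transfer (R : realType) (X : Type)
    (tri vir : X -> X -> X -> X) (T T' : tangle R) : Prop :=
  forall rev Delta (psi phi psi' phi' : R * R -> R * R) (D D' : diagram R)
    (f : region D -> X),
  chart Delta psi phi -> chart Delta psi' phi' ->
  (forall x, bdisk x -> psi x = psi' x) ->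
  draws D psi T rev -> draws D' psi' T' rev ->
  (forall p u m, ~ Delta p -> (passes D p u m <-> passes D' p u m)) ->
  coloring tri vir f ->
  exists! f' : region D' -> X, coloring tri vir f' /\ agree_outside Delta f f'.

Lemma model_transfer (R : realType) (X : Type) (tri vir : X -> X -> X -> X)
    (T T' : tangle R) (L L' : Type) (P : L -> set (R * R)) base cs
    (P' : L' -> set (R * R)) base' cs' (arcs : L -> L' -> Prop) :
  tangle_model T P base cs -> tangle_model T' P' base' cs' ->
  (forall j j', arcs j j' <-> exists x, [/\ bdisk x, P j x & P' j' x]) ->
  (forall x, bdisk x -> (exists j, P j x) <-> (exists j', P' j' x)) ->
  (forall rev (col : L -> X),
    (forall c, cs c -> crossing_rel tri vir rev col c) ->
    exists col' : L' -> X,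
      (forall c, cs' c -> crossing_rel tri vir rev col' c) /\
      forall j j', arcs j j' -> col j = col' j') ->
  (forall rev (col1 col2 : L' -> X),
    (forall c, cs' c -> crossing_rel tri vir rev col1 c) ->
    (forall c, cs' c -> crossing_rel tri vir rev col2 c) ->
    (forall j j', arcs j j' -> col1 j' = col2 j') ->
    forall j', col1 j' = col2 j') ->
  colorings_transfer tri vir T T'.
Proof.
move=> HT HT' arcsP ends ex uniq rev Delta psi phi psi' phi' D D' f.
move=> Hc Hc' Hpsi HD HD' Hout Hf.
exact: (transfer_coloring HT HT' arcsP ends (ex rev) (uniq rev) Hc Hc' Hpsi HD HD'
  Hout Hf).
Qed.

(** * Models of the local moves *)

Section ModelTools.
Variable R : realType.
Implicit Types (x y w : R * R) (S : set (R * R)).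

Lemma derive1_pair (f g : R -> R) (t a b : R) :
  is_derive t 1 f a -> is_derive t 1 g b ->
  derive1 (fun t => (f t, g t) : R * R) t = (a, b).
Proof.
move=> [df <-] [dg <-]; rewrite derive1E.
have Df : differentiable f t by apply/derivable1_diffP.
have Dg : differentiable g t by apply/derivable1_diffP.
rewrite deriveE; last exact: differentiable_pair.
by rewrite diff_pair // -!deriveE.
Qed.

Lemma derive1_poly (p q : {poly R}) (t : R) (f : R -> R * R) :
  (forall s, f s = (p.[s], q.[s])) -> derive1 f t = ((deriv p).[t], (deriv q).[t]).
Proof.
move=> E; have -> : f = fun s => (p.[s], q.[s]) by apply/funext.
by apply: derive1_pair.
Qed.

(** A side of a line or of a parabola with vertical axis; these curves cut out all the pieces of
    moves II and III. *)
Definition side (a b c d : R) : set (R * R) :=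
  [set x | 0 < a * x.2 + b * x.1 ^+ 2 + c * x.1 + d].

Lemma open_side a b c d : open (side a b c d).
Proof.
apply: (@open_comp _ _ (fun x : R * R => a * x.2 + b * x.1 ^+ 2 + c * x.1 + d)
  [set y | 0 < y]); last exact: open_gt.
move=> x _; apply: cvgD; last exact: cvg_cst.
apply: cvgD; last by apply: cvgM; [exact: cvg_cst|exact: cvg_fst].
apply: cvgD; apply: cvgM; try exact: cvg_cst; first exact: cvg_snd.
by apply: (@cvgM _ _ _ _ fst fst); exact: cvg_fst.
Qed.

Lemma into_setI S S' x w : into S x w -> into S' x w -> into (S `&` S') x w.
Proof.
by move=> HS HS' a b Ha Hb; apply: filterI; [exact: HS|exact: HS'].
Qed.

Lemma into_open S x w : open S -> S x -> into S x w.
Proof.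
move=> oS Sx a b Ha Hb.
have e0 : e @[e --> 0^'+] --> (0 : R) by apply: cvg_at_right_filter; exact: cvg_id.
have H1 : x.1 + e * a e @[e --> 0^'+] --> x.1.
  have : x.1 + e * a e @[e --> 0^'+] --> x.1 + 0 * w.1.
    by apply: cvgD; [exact: cvg_cst|exact: cvgM].
  by rewrite mul0r addr0.
have H2 : x.2 + e * b e @[e --> 0^'+] --> x.2.
  have : x.2 + e * b e @[e --> 0^'+] --> x.2 + 0 * w.2.
    by apply: cvgD; [exact: cvg_cst|exact: cvgM].
  by rewrite mul0r addr0.
have N : nbhs (x.1, x.2) S by case: x Sx {H1 H2} => x1 x2 Sx; exact: open_nbhs_nbhs.
exact: (cvg_pair H1 H2 N).
Qed.

(* The value of the equation of a side at [x + e w] is [e] times an expression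
   that tends to its derivative along [w]. *)
Lemma into_side a b c d x w :
  a * x.2 + b * x.1 ^+ 2 + c * x.1 + d = 0 ->
  0 < a * w.2 + (2 * b * x.1 + c) * w.1 -> into (side a b c d) x w.
Proof.
move=> E0 d0 u v Hu Hv.
have e0 : e @[e --> 0^'+] --> (0 : R) by apply: cvg_at_right_filter; exact: cvg_id.
have H : a * v e + (2 * b * x.1 + c) * u e + b * (e * (u e * u e)) @[e --> 0^'+]
    --> a * w.2 + (2 * b * x.1 + c) * w.1 + b * (0 * (w.1 * w.1)).
  apply: cvgD; first by apply: cvgD; apply: cvgM => //; exact: cvg_cst.
  by apply: cvgM; [exact: cvg_cst|apply: cvgM => //; exact: cvgM].
rewrite mul0r mulr0 addr0 in H.
have Q := @cvgr_gt _ _ _ (at_right_proper_filter (0 : R)) _ _ H _ d0.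
have P : \forall e \near 0^'+, (0 : R) < e by exact: nbhs_right_gt.
apply: filterS2 P Q => e ep He; rewrite /side /=.
have -> : a * (x.2 + e * v e) + b * (x.1 + e * u e) ^+ 2 + c * (x.1 + e * u e) + d
  = (a * x.2 + b * x.1 ^+ 2 + c * x.1 + d)
    + e * (a * v e + (2 * b * x.1 + c) * u e + b * (e * (u e * u e))) by ring.
by rewrite E0 add0r mulr_gt0.
Qed.

Lemma into_side_or a b c d x w :
  (a * x.2 + b * x.1 ^+ 2 + c * x.1 + d = 0 /\
     0 < a * w.2 + (2 * b * x.1 + c) * w.1) \/
  0 < a * x.2 + b * x.1 ^+ 2 + c * x.1 + d -> into (side a b c d) x w.
Proof.
case=> [[E0 d0]|H]; first exact: into_side.
by apply: into_open => //; exact: open_side.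
Qed.

(** For [b <= 0] the defining function is concave. *)
Lemma side_convex a b c d x y (t : R) : b <= 0 -> 0 <= t <= 1 ->
  side a b c d x -> side a b c d y -> side a b c d (x + t *: (y - x)).
Proof.
case: x y => [x1 x2] [y1 y2] b0 /andP[t0 t1].
rewrite /side /= /GRing.scale /= => Hx Hy.
have -> : a * (x2 + t * (y2 - x2)) + b * (x1 + t * (y1 - x1)) ^+ 2
    + c * (x1 + t * (y1 - x1)) + d
  = (1 - t) * (a * x2 + b * x1 ^+ 2 + c * x1 + d)
    + t * (a * y2 + b * y1 ^+ 2 + c * y1 + d)
    + (- b) * (t * (1 - t) * (y1 - x1) ^+ 2) by ring.
have H : 0 <= (- b) * (t * (1 - t) * (y1 - x1) ^+ 2).
  by apply: mulr_ge0; [lra|apply: mulr_ge0; [nra|exact: sqr_ge0]].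
apply: ltr_wpDr => //.
have [->|tn] := eqVneq t 0; first by rewrite subr0 mul1r mul0r addr0.
apply: ltr_wpDl; first by apply: mulr_ge0; lra.
by rewrite mulr_gt0 // lt0r tn.
Qed.

Lemma cdisk_convex x y (t : R) : 0 <= t <= 1 ->
  cdisk x -> cdisk y -> cdisk (x + t *: (y - x)).
Proof.
case: x y => [x1 x2] [y1 y2] /andP[t0 t1].
rewrite /cdisk /= /GRing.scale /= !ler_norml.
move=> [/andP[? ?] /andP[? ?]] [/andP[? ?] /andP[? ?]].
by split; apply/andP; split; nra.
Qed.

Lemma joined_horizontal S (a b c : R) :
  (forall s, (a <= s <= b) || (b <= s <= a) -> S (s, c)) -> joined S (a, c) (b, c).
Proof.
move=> H; apply: joined_segment => t /andP[t0 t1].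
rewrite (_ : _ + _ = (a + t * (b - a), c)).
  by apply: H; case: (lerP a b) => ab; apply/orP; [left|right];
    apply/andP; split; nra.
by apply: injective_projections; rewrite /= /GRing.scale /=; ring.
Qed.

Lemma joined_vertical S (a b c : R) :
  (forall s, (a <= s <= b) || (b <= s <= a) -> S (c, s)) -> joined S (c, a) (c, b).
Proof.
move=> H; apply: joined_segment => t /andP[t0 t1].
rewrite (_ : _ + _ = (c, a + t * (b - a))).
  by apply: H; case: (lerP a b) => ab; apply/orP; [left|right];
    apply/andP; split; nra.
by apply: injective_projections; rewrite /= /GRing.scale /=; ring.
Qed.

Lemma cdiskP (a b : R) : cdisk (a, b) <-> [/\ -1 <= a, a <= 1, -1 <= b & b <= 1].
Proof.
rewrite /cdisk /= !ler_norml; split; first by move=> [/andP[? ?] /andP[? ?]].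
by move=> [-> -> -> ->].
Qed.

Lemma joined_cdisk_h S (a b c : R) : cdisk (a, c) -> cdisk (b, c) ->
  (forall s, (a <= s <= b) || (b <= s <= a) -> S (s, c)) ->
  joined (S `&` @cdisk R) (a, c) (b, c).
Proof.
move=> /cdiskP[? ? ? ?] /cdiskP[? ? ? ?] Hs; apply: joined_horizontal => s Hsd.
split; first exact: Hs.
by apply/cdiskP; case/orP: Hsd => /andP[? ?]; split; lra.
Qed.

Lemma joined_cdisk_v S (a b c : R) : cdisk (c, a) -> cdisk (c, b) ->
  (forall s, (a <= s <= b) || (b <= s <= a) -> S (c, s)) ->
  joined (S `&` @cdisk R) (c, a) (c, b).
Proof.
move=> /cdiskP[? ? ? ?] /cdiskP[? ? ? ?] Hs; apply: joined_vertical => s Hsd.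
split; first exact: Hs.
by apply/cdiskP; case/orP: Hsd => /andP[? ?]; split; lra.
Qed.

Lemma odiskP (a b : R) : odisk (a, b) <-> [/\ -1 < a, a < 1, -1 < b & b < 1].
Proof.
rewrite /odisk /= !ltr_norml; split; first by move=> [/andP[? ?] /andP[? ?]].
by move=> [-> -> -> ->].
Qed.

Lemma bdiskP (a b : R) : cdisk (a, b) ->
  bdisk (a, b) <-> [\/ a = -1, a = 1, b = -1 | b = 1].
Proof.
move=> Hc; split=> [[_ nO]|Hb].
  apply: contrapT => N; apply: nO; move/cdiskP: Hc => [a1 a2 b1 b2].
  apply/odiskP; rewrite !lt_def a1 a2 b1 b2 !andbT.
  by split; apply/eqP => E; apply: N; rewrite E;
    [apply: Or41|apply: Or42|apply: Or43|apply: Or44].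
split=> // /odiskP [a1 a2 b1 b2].
by case: Hb => E; rewrite E ltxx in a1 a2 b1 b2.
Qed.

End ModelTools.

(** * Move III *)

Inductive hexagon := HexA | HexB | HexC | HexD | HexE | HexG | HexIn.

Section Triangle.
Variables (R : realType) (role : nat -> nat -> passage).
Variable up : bool.

Let e : R := if up then 1 else -1.

(* The signs of [y - x / 2], [y + x / 2] and [y - e (1 - x^2) / 3] on the seven
   pieces; the outer pieces are lettered as the arguments of [braid]. *)
Definition tri_sign (j : hexagon) : R * R * R :=
  match j with
  | HexA => (1, 1, 1)
  | HexB => (1, -1, 1)
  | HexC => (1, -1, -1)
  | HexD => (-1, -1, -1)
  | HexG => (-1, 1, -1)
  | HexE => (-1, 1, 1)
  | HexIn => (e, e, - e)
  end.

Definition tri_piece (j : hexagon) : set (R * R) :=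
  let: (s0, s1, s2) := tri_sign j in
  side s0 0 (- (s0 / 2)) 0 `&` side s1 0 (s1 / 2) 0 `&`
  side s2 (s2 * e / 3) 0 (- (s2 * e / 3)).

(** The base points of the outer pieces are on the boundary of the disk, so that they also witness
    the arcs common to both sides of the move. *)
Definition tri_base (j : hexagon) : R * R :=
  match j with
  | HexA => (0, 1)
  | HexB => (-1, 1 / 4)
  | HexC => (-1, - (1 / 4))
  | HexD => (0, -1)
  | HexG => (1, - (1 / 4))
  | HexE => (1, 1 / 4)
  | HexIn => (0, e / 6)
  end.

(** All strands run from left to right, so the one of smaller slope comes first, and the left,
    incoming, right and outgoing quadrants are the top, left, bottom and right ones of the
    picture. *)
Definition tri_crossing01 : crossing R hexagon :=
  Crossing (0, 0) 1 0 (role 1 0) (1, - (1 / 2)) (1, 1 / 2)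
    (if up then HexIn else HexA) (if up then HexC else HexB)
    (if up then HexD else HexIn) (if up then HexG else HexE).

Definition tri_crossing02 : crossing R hexagon :=
  Crossing (e / 2, e / 4) 2 0 (role 2 0) (1, - (1 / 3)) (1, 1 / 2)
    (if up then HexA else HexB) (if up then HexIn else HexC)
    (if up then HexG else HexD) (if up then HexE else HexIn).

Definition tri_crossing12 : crossing R hexagon :=
  Crossing (- (e / 2), e / 4) 1 2 (role 1 2) (1, - (1 / 2)) (1, 1 / 3)
    (if up then HexA else HexE) (if up then HexB else HexIn)
    (if up then HexC else HexD) (if up then HexIn else HexG).

Definition tri_crossings : set (crossing R hexagon) :=
  [set c | [\/ c = tri_crossing01, c = tri_crossing02 | c = tri_crossing12]].

Lemma tri_pieceP j x y : tri_piece j (x, y) <->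
  [/\ 0 < (tri_sign j).1.1 * (y - x / 2), 0 < (tri_sign j).1.2 * (y + x / 2) &
      0 < (tri_sign j).2 * (y - e * (1 - x ^+ 2) / 3)].
Proof.
rewrite /tri_piece; case: (tri_sign j) => [[s0 s1] s2]; rewrite /side /=.
have -> : s0 * y + 0 * x ^+ 2 + - (s0 / 2) * x + 0 = s0 * (y - x / 2) by ring.
have -> : s1 * y + 0 * x ^+ 2 + s1 / 2 * x + 0 = s1 * (y + x / 2) by ring.
have -> : s2 * y + s2 * e / 3 * x ^+ 2 + 0 * x + - (s2 * e / 3) =
  s2 * (y - e * (1 - x ^+ 2) / 3) by ring.
by split=> [[[? ?] ?]|[? ? ?]].
Qed.

Lemma tri_base_in j : cdisk (tri_base j) /\ tri_piece j (tri_base j).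
Proof.
rewrite /tri_base /e; split.
  by case: j; apply/cdiskP; case: up; split; lra.
by case: j; apply/tri_pieceP; rewrite /= /e; case: up; split; lra.
Qed.

Lemma tri_disjoint j j' x : cdisk x -> tri_piece j x -> tri_piece j' x -> j = j'.
Proof.
case: x => x y _ /tri_pieceP + /tri_pieceP.
by case: j; case: j' => //; rewrite /= /e; case: up => -[H1 H2 H3] [H4 H5 H6];
  exfalso; lra.
Qed.

Lemma tri_cover x : cdisk x -> (exists j, tri_piece j x) \/
  exists k t, [/\ (k < 3)%N, -1 <= t <= 1 & strand (tangle_triangle role e) k t = x].
Proof.
case: x => x y /cdiskP [x1 x2 y1 y2].
have Hx : -1 <= x <= 1 by rewrite x1.
case: (ltgtP y (x / 2)) => H0; last by right; exists 0%N, x; split=> //=; rewrite H0.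
all: case: (ltgtP y (- (x / 2))) => H1;
  last by right; exists 1%N, x; split=> //=; rewrite H1.
all: case: (ltgtP y (e * (1 - x ^+ 2) / 3)) => H2;
  last by right; exists 2%N, x; split=> //=; rewrite H2.
all: left.
(* Of the sign patterns [(1, 1, -1)] and [(-1, -1, 1)], one is the inner piece and the other is
   empty in the disk, depending on [e]. The last alternative settles both. *)
all: by [exists HexD; apply/tri_pieceP; split=> /=; lra
  |exists HexC; apply/tri_pieceP; split=> /=; lra
  |exists HexB; apply/tri_pieceP; split=> /=; lra
  |exists HexA; apply/tri_pieceP; split=> /=; lra
  |exists HexE; apply/tri_pieceP; split=> /=; lra
  |exists HexG; apply/tri_pieceP; split=> /=; lra
  |exists HexIn; apply/tri_pieceP; move: H2; rewrite /= /e; case: up => H2; split; nra].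
Qed.

(** The pieces on the convex side of the parabola are convex. In the others, a segment parallel to
    an axis leads away from the parabola to the border of the disk, and a second one follows the
    border to the base point. *)
Lemma tri_joined j x : cdisk x -> tri_piece j x ->
  joined (tri_piece j `&` @cdisk R) (tri_base j) x.
Proof.
have [cb Pb] := tri_base_in j => cx Px.
have convex : (tri_sign j).2 * e <= 0 ->
    joined (tri_piece j `&` @cdisk R) (tri_base j) x.
  move=> s2; apply: joined_segment => t Ht; split; last exact: cdisk_convex.
  move: Pb Px; rewrite /tri_piece; case: (tri_sign j) s2 => [[s0 s1] s2] /= s2e.
  by move=> [[B0 B1] B2] [[P0 P1] P2]; split; first split;
    apply: side_convex => //; lra.
have [//|s2] := lerP ((tri_sign j).2 * e) 0.
clear convex cb Pb; apply: joined_sym; case: x cx Px => x y cx.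
move/cdiskP: (cx) => [x1 x2 y1 y2] /tri_pieceP [P0 P1 P2].
have x21 : x ^+ 2 <= 1 by nra.
have sqN (s : R) : s <= x -> x < 0 -> x ^+ 2 <= s ^+ 2 by nra.
have sqP (s : R) : x <= s -> 0 < x -> x ^+ 2 <= s ^+ 2 by nra.
have sq0 (s : R) : 0 <= s ^+ 2 by exact: sqr_ge0.
have V c d : cdisk (c, y) -> cdisk (c, d) ->
    (forall s, (y <= s <= d) || (d <= s <= y) ->
      [/\ 0 < (tri_sign j).1.1 * (s - c / 2), 0 < (tri_sign j).1.2 * (s + c / 2) &
      0 < (tri_sign j).2 * (s - e * (1 - c ^+ 2) / 3)]) ->
    joined (tri_piece j `&` @cdisk R) (c, y) (c, d).
  by move=> Hy Hd Hs; apply: joined_cdisk_v => // s Hsd; apply/tri_pieceP/Hs.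
have H c d : cdisk (x, c) -> cdisk (d, c) ->
    (forall s, (x <= s <= d) || (d <= s <= x) ->
      [/\ 0 < (tri_sign j).1.1 * (c - s / 2), 0 < (tri_sign j).1.2 * (c + s / 2) &
      0 < (tri_sign j).2 * (c - e * (1 - s ^+ 2) / 3)]) ->
    joined (tri_piece j `&` @cdisk R) (x, c) (d, c).
  by move=> Hx Hd Hs; apply: joined_cdisk_h => // s Hsd; apply/tri_pieceP/Hs.
case: j P0 P1 P2 s2 V H => /=; rewrite /e /tri_base; case: up;
  move=> P0 P1 P2 s2 V H; try by exfalso; lra.
- apply: (joined_trans (V x 1 _ _ _)); last apply: H;
    try by apply/cdiskP; split; lra.
    by move=> s /orP[] /andP[? ?]; split; lra.
  by move=> s /orP[] /andP[? ?]; have := sq0 s; split; lra.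
- apply: (joined_trans (H y (-1) _ _ _)); last apply: V;
    try by apply/cdiskP; split; lra.
    by move=> s Hs; have := sqN s; case/orP: Hs => /andP[? ?] Hsx; split; lra.
  by move=> s /orP[] /andP[? ?]; split; lra.
- apply: (joined_trans (H y (-1) _ _ _)); last apply: V;
    try by apply/cdiskP; split; lra.
    by move=> s Hs; have := sqN s; case/orP: Hs => /andP[? ?] Hsx; split; lra.
  by move=> s /orP[] /andP[? ?]; split; lra.
- apply: (joined_trans (V x (-1) _ _ _)); last apply: H;
    try by apply/cdiskP; split; lra.
    by move=> s /orP[] /andP[? ?]; split; lra.
  by move=> s /orP[] /andP[? ?]; have := sq0 s; split; lra.
- apply: (joined_trans (H y 1 _ _ _)); last apply: V;
    try by apply/cdiskP; split; lra.
    by move=> s Hs; have := sqP s; case/orP: Hs => /andP[? ?] Hsx; split; lra.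
  by move=> s /orP[] /andP[? ?]; split; lra.
- apply: (joined_trans (H y 1 _ _ _)); last apply: V;
    try by apply/cdiskP; split; lra.
    by move=> s Hs; have := sqP s; case/orP: Hs => /andP[? ?] Hsx; split; lra.
  by move=> s /orP[] /andP[? ?]; split; lra.
Qed.

Lemma tri_off j k t : (k < 3)%N -> -1 <= t <= 1 ->
  ~ tri_piece j (strand (tangle_triangle role e) k t).
Proof.
by case: k => [|[|[|//]]] _ _ /= /tri_pieceP [];
  [|move=> _|move=> _ _]; rewrite ?subrr ?addNr mulr0 ltxx.
Qed.

Lemma tri_odisk k t : (k < 3)%N -> -1 < t < 1 ->
  odisk (strand (tangle_triangle role e) k t).
Proof.
case: k => [|[|[|//]]] _ /andP[t1 t2] /=; apply/odiskP; split; try lra;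
  rewrite /e; case: up; nra.
Qed.

Lemma tri_bdisk k : (k < 3)%N ->
  bdisk (strand (tangle_triangle role e) k (-1)) /\
  bdisk (strand (tangle_triangle role e) k 1).
Proof.
case: k => [|[|[|//]]] _ /=; split; apply/bdiskP; try by [apply: Or41|apply: Or42];
  apply/cdiskP; split; try lra; rewrite /e; case: up; lra.
Qed.

Lemma tri_derive k t : (k < 3)%N ->
  derive1 (strand (tangle_triangle role e) k) t =
  (1, match k with 0%N => 1 / 2 | 1%N => - (1 / 2) | _ => - (2 * e * t / 3) end).
Proof.
case: k => [|[|[|//]]] _ /=.
- rewrite (@derive1_poly _ 'X ((1 / 2)%:P * 'X)) => [|s].
    by rewrite !poly.derivE !hornerE.
  by rewrite !hornerE; congr pair; ring.
- rewrite (@derive1_poly _ 'X ((- (1 / 2))%:P * 'X)) => [|s].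
    by rewrite !poly.derivE !hornerE.
  by rewrite !hornerE; congr pair; ring.
- rewrite (@derive1_poly _ 'X ((e / 3)%:P * (1 - 'X^2))) => [|s].
    by rewrite !poly.derivE !hornerE; congr pair; ring.
  by rewrite !hornerE; congr pair; ring.
Qed.

Lemma tri_sectors c a b : tri_crossings c -> 0 < a -> 0 < b ->
  [/\ into (tri_piece (cleft c)) (cpoint c) (b *: cdir2 c - a *: cdir1 c),
      into (tri_piece (cin c)) (cpoint c) (- (a *: cdir1 c + b *: cdir2 c)),
      into (tri_piece (cright c)) (cpoint c) (a *: cdir1 c - b *: cdir2 c) &
      into (tri_piece (cout c)) (cpoint c) (a *: cdir1 c + b *: cdir2 c)].
Proof.
move=> Hc a0 b0.
have L j x w : into (side (tri_sign j).1.1 0 (- ((tri_sign j).1.1 / 2)) 0) x w ->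
    into (side (tri_sign j).1.2 0 ((tri_sign j).1.2 / 2) 0) x w ->
    into (side (tri_sign j).2 ((tri_sign j).2 * e / 3) 0
      (- ((tri_sign j).2 * e / 3))) x w -> into (tri_piece j) x w.
  rewrite /tri_piece; case: (tri_sign j) => [[s0 s1] s2] /= H0 H1 H2.
  by apply: into_setI => //; apply: into_setI.
(* Each curve either goes through the crossing, where slopes decide, or misses it, where a strict
   inequality at the crossing is enough. *)
by case: Hc => ->; split; apply: L; apply: into_side_or;
  rewrite /= /GRing.scale /= /tri_sign /e; case: up => /=;
  first [left; split; lra|right; lra].
Qed.

End Triangle.

Section TriangleModel.
Variables (R : realType) (role : nat -> nat -> passage).
Variable up : bool.
Hypothesis role_swap : forall k l, k != l -> role l k = swap (role k l).
Hypothesis role_neq : forall k l, k != l -> role k l <> Simple.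

Let e : R := if up then 1 else -1.

Lemma tri_model : tangle_model (tangle_triangle role e) (@tri_piece R up)
  (@tri_base R up) (@tri_crossings R role up).
Proof.
have e0 : (e / 2 == 0) = false by apply/eqP; rewrite /e; case: up; lra.
have e1 : (- (e / 2) == 0) = false by apply/eqP; rewrite /e; case: up; lra.
have e2 : (- (e / 2) == e / 2) = false by apply/eqP; rewrite /e; case: up; lra.
have et : -1 < e / 2 < 1 by rewrite /e; case: up; apply/andP; split; lra.
have et' : -1 < - (e / 2) < 1 by rewrite /e; case: up; apply/andP; split; lra.
have zt : -1 < (0 : R) < 1 by apply/andP; split; lra.
have dE (u v w : R) : v = w -> (u, v) = (u, w) by move=> ->.
have E2 : e * e = 1 by rewrite /e; case: up; lra.
have drv k t : (k < 3)%N -> derive1 (strand (tangle_triangle role e) k) t =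
    (1, match k with 0%N => 1 / 2 | 1%N => - (1 / 2) | _ => - (2 * e * t / 3) end).
  exact: tri_derive.
split.
- exact: tri_odisk.
- exact: tri_bdisk.
- move=> j; rewrite /tri_piece; case: (tri_sign _ _ j) => [[s0 s1] s2].
  by do 2![apply: openI; last exact: open_side]; exact: open_side.
- exact: tri_disjoint.
- exact: tri_base_in.
- exact: tri_joined.
- exact: tri_off.
- exact: tri_cover.
- by move=> c [] ->; apply/odiskP; rewrite -/e /e; case: up; split; lra.
- by move=> c [] -> /=; apply: role_neq.
- by move=> c [] -> /=; rewrite /det2 /=; lra.
- move=> c [] -> /=; rewrite -/e.
  + exists 0; split=> //=; [apply: dE; lra|exact: (drv 1%N)|by rewrite eqxx].
  + exists (e / 2); split=> //=; [apply: dE; nra| |by rewrite eqxx].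
    by apply: etrans (drv 2%N _ isT) _; apply: dE; nra.
  + exists (- (e / 2)); split=> //=; [apply: dE; lra|exact: (drv 1%N)|].
    by rewrite e1 eqxx.
- move=> c [] -> /=; rewrite -/e.
  + exists 0; split=> //=; [apply: dE; lra|exact: (drv 0%N)|].
    by rewrite eqxx role_swap.
  + exists (e / 2); split=> //=; [apply: dE; lra|exact: (drv 0%N)|].
    by rewrite e0 eqxx role_swap.
  + exists (- (e / 2)); split=> //=; [apply: dE; nra| |].
      by apply: etrans (drv 2%N _ isT) _; apply: dE; nra.
    by rewrite e2 eqxx role_swap.
- exact: tri_sectors.
- move=> c k t Hc kn Ht E; rewrite drv //; move: E.
  case: Hc => -> /=; rewrite -/e; case: k kn => [|[|[|//]]] _ /= [-> E].
  + by right; rewrite eqxx -role_swap.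
  + by left; rewrite eqxx.
  + by exfalso; move: E; rewrite /e; case: up; lra.
  + by right; rewrite e0 eqxx -role_swap.
  + by exfalso; move: E; rewrite /e; case: up; lra.
  + by left; rewrite eqxx; split=> //; apply: dE; nra.
  + by exfalso; move: E; rewrite /e; case: up; lra.
  + by left; rewrite e1 eqxx.
  + by right; rewrite e2 eqxx -role_swap //; split=> //; apply: dE; nra.
- move=> k t kn Ht; case: k kn => [|[|[|//]]] _ /=.
  + case: eqP => [-> _|_].
      by exists (@tri_crossing01 R role up); [apply: Or31|congr pair; lra].
    case: eqP => [-> _|//].
    by exists (@tri_crossing02 R role up); [apply: Or32|apply: dE; rewrite -/e; lra].
  + case: eqP => [-> _|_].
      by exists (@tri_crossing01 R role up); [apply: Or31|congr pair; lra].
    case: eqP => [-> _|//].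
    by exists (@tri_crossing12 R role up); [apply: Or33|apply: dE; rewrite -/e; lra].
  + case: eqP => [-> _|_].
      by exists (@tri_crossing02 R role up); [apply: Or32|apply: dE; rewrite -/e; nra].
    case: eqP => [-> _|//].
    by exists (@tri_crossing12 R role up); [apply: Or33|apply: dE; rewrite -/e; nra].
Qed.

End TriangleModel.

(** Both parabolas meet the vertical sides of the square at height 0 and stay away from the
    horizontal ones, so replacing one by the other changes no sign on the boundary. *)
Lemma tri_boundary (R : realType) up j (x : R * R) :
  bdisk x -> tri_piece up j x -> j <> HexIn /\ tri_piece (~~ up) j x.
Proof.
case: x => x y Hx; have cx := Hx.1; move/(bdiskP cx): Hx => Hx.
move/cdiskP: cx => [x1 x2 y1 y2] /tri_pieceP Hj.
have jin : j <> HexIn.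
  move=> Ej; move: Hj; rewrite Ej /=; case: up => -[H0 H1 H2];
  by case: Hx => E; rewrite E in H0 H1 H2; nra.
split=> //; apply/tri_pieceP.
have Es (s : R) : s = 1 \/ s = -1 ->
  0 < s * (y - (if up then 1 else -1) * (1 - x ^+ 2) / 3) ->
  0 < s * (y - (if ~~ up then 1 else -1) * (1 - x ^+ 2) / 3).
  by clear Hj; case=> ->; case: up => /=; case: Hx => E; rewrite E; nra.
case: j jin Hj => //= _ [H0 H1 H2]; split=> //;
  by apply: Es => //; by [left|right].
Qed.

Section TriangleMove.
Variables (R : realType) (X : Type) (tri vir : X -> X -> X -> X).
Hypothesis HX : virtual_tribracket tri vir.
Variable role : nat -> nat -> passage.
Hypothesis role_swap : forall k l, k != l -> role l k = swap (role k l).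
Hypothesis role_neq : forall k l, k != l -> role k l <> Simple.
Hypothesis Hbraid : braid_roles tri vir role 1 2 0.

(** With this lettering, the crossings before and after the move give the two sides of [braid]. *)
Lemma tri_crossings_rel rev (col : hexagon -> X) up :
  (forall c, @tri_crossings R role up c -> crossing_rel tri vir rev col c) <->
  let P := rel tri vir (role 1 2) (rev 1%N) (rev 2%N) in
  let Q := rel tri vir (role 1 0) (rev 1%N) (rev 0%N) in
  let S := rel tri vir (role 2 0) (rev 2%N) (rev 0%N) in
  if up then [/\ P (col HexA) (col HexB) (col HexC) (col HexIn),
    Q (col HexIn) (col HexC) (col HexD) (col HexG) &
    S (col HexA) (col HexIn) (col HexG) (col HexE)]
  else [/\ S (col HexB) (col HexC) (col HexD) (col HexIn),
    Q (col HexA) (col HexB) (col HexIn) (col HexE) &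
    P (col HexE) (col HexIn) (col HexD) (col HexG)].
Proof.
split=> [H|].
  have H1 := H _ (Or31 _ _ erefl); have H2 := H _ (Or32 _ _ erefl).
  by have H3 := H _ (Or33 _ _ erefl); move: H1 H2 H3; case: up {H}.
by case: up => /= -[H1 H2 H3] c [] ->.
Qed.

Lemma tri_transfer up :
  colorings_transfer tri vir (tangle_triangle role (if up then 1 else (-1 : R)))
    (tangle_triangle role (if ~~ up then 1 else -1)).
Proof.
apply: (model_transfer (arcs := fun j j' => j = j' /\ j <> HexIn)
  (tri_model R up role_swap role_neq) (tri_model R (~~ up) role_swap role_neq)).
- move=> j j'; split=> [[<- jin]|[x [Hx Pj Pj']]].
    have [cb Pb] := tri_base_in R up j.
    have bb : bdisk (tri_base R up j).
      move: cb; rewrite /tri_base; case: j jin {Pb} => // _ cb; apply/bdiskP => //;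
      by [apply: Or41|apply: Or42|apply: Or43|apply: Or44].
    by exists (tri_base R up j); split=> //; case: (tri_boundary bb Pb).
  have [jin Pj2] := tri_boundary Hx Pj.
  by split=> //; apply: tri_disjoint Pj2 Pj'; case: Hx.
- move=> x Hx; split=> -[j Pj]; have [_ Pj'] := tri_boundary Hx Pj; exists j => //.
  by rewrite negbK in Pj'.
- move=> rev col /tri_crossings_rel H.
  suff [y Hy] : exists y, forall c, @tri_crossings R role (~~ up) c ->
      crossing_rel tri vir rev (fun j => if j is HexIn then y else col j) c.
    by exists (fun j => if j is HexIn then y else col j); split=> // j _ [<-]; case: j.
  have B := Hbraid (rev 1%N) (rev 2%N) (rev 0%N)
    (col HexA) (col HexB) (col HexC) (col HexD) (col HexE) (col HexG).
  case: up H => /= H.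
    have [|y Hy] := B.1; first by exists (col HexIn).
    by exists y; apply/tri_crossings_rel.
  have [|y Hy] := B.2; first by exists (col HexIn).
  by exists y; apply/tri_crossings_rel.
- move=> rev col1 col2 /tri_crossings_rel H1 /tri_crossings_rel H2 E.
  have Ej j : j <> HexIn -> col1 j = col2 j by move=> jin; apply: (E j).
  (* The inner color is the output of a crossing whose other three colors are outer ones. *)
  have U (m : passage) u v l i r o o' : m <> Simple ->
      rel tri vir m u v l i r o -> rel tri vir m u v l i r o' -> o = o'.
    move=> Hm Ho Ho'; have [z [_ Hz]] := rel_out HX u v l i r Hm.
    by rewrite -(Hz _ Ho) -(Hz _ Ho').
  move=> j; case: (j) (Ej j) => [H|H|H|H|H|H|_]; try exact: H.
  case: up H1 H2 => /= -[H1 _ _] [H2 _ _].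
    rewrite (Ej HexB) // (Ej HexC) // (Ej HexD) // in H1.
    by apply: U H1 H2; apply: role_neq.
  rewrite (Ej HexA) // (Ej HexB) // (Ej HexC) // in H1.
  by apply: U H1 H2; apply: role_neq.
Qed.

End TriangleMove.

(** * Move II *)

Inductive strips := Ptop | Pmid | Pbot.
Inductive bigon_pieces := Btop | Bleft | Bmid | Bright | Bbot.

Section Bigon.
Variables (R : realType) (m : passage).
Hypothesis m_neq : m <> Simple.

Definition strip (j : strips) : set (R * R) :=
  match j with
  | Ptop => side 1 0 0 (- (1 / 2))
  | Pmid => side 1 0 0 (1 / 2) `&` side (-1) 0 0 (1 / 2)
  | Pbot => side (-1) 0 0 (- (1 / 2))
  end.

Definition strip_base (j : strips) : R * R :=
  match j with Ptop => (0, 1) | Pmid => (0, 0) | Pbot => (0, -1) end.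

(** The strands are the parabolas of heights [2/3 x^2 - 1/6] and its opposite. The left and right
    pieces satisfy the same two inequalities, and the sign of [x] separates them. *)
Definition bigon_piece (j : bigon_pieces) : set (R * R) :=
  match j with
  | Btop => side 1 (- (2 / 3)) 0 (1 / 6) `&` side 1 (2 / 3) 0 (- (1 / 6))
  | Bbot => side (-1) (2 / 3) 0 (- (1 / 6)) `&` side (-1) (- (2 / 3)) 0 (1 / 6)
  | Bmid => side 1 (- (2 / 3)) 0 (1 / 6) `&` side (-1) (- (2 / 3)) 0 (1 / 6)
  | Bleft => side (-1) (2 / 3) 0 (- (1 / 6)) `&` side 1 (2 / 3) 0 (- (1 / 6)) `&`
      side 0 0 (-1) 0
  | Bright => side (-1) (2 / 3) 0 (- (1 / 6)) `&` side 1 (2 / 3) 0 (- (1 / 6)) `&`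
      side 0 0 1 0
  end.

Definition bigon_base (j : bigon_pieces) : R * R :=
  match j with
  | Btop => (0, 1)
  | Bleft => (-1, 0)
  | Bmid => (0, 0)
  | Bright => (1, 0)
  | Bbot => (0, -1)
  end.

Definition bigon_crossing1 : crossing R bigon_pieces :=
  Crossing (- (1 / 2), 0) 0 1 m (1, - (2 / 3)) (1, 2 / 3) Btop Bleft Bbot Bmid.

Definition bigon_crossing2 : crossing R bigon_pieces :=
  Crossing (1 / 2, 0) 1 0 (swap m) (1, - (2 / 3)) (1, 2 / 3) Btop Bmid Bbot Bright.

Definition bigon_crossings : set (crossing R bigon_pieces) :=
  [set c | c = bigon_crossing1 \/ c = bigon_crossing2].

Lemma strip_base_in j : cdisk (strip_base j) /\ strip j (strip_base j).
Proof.
by case: j; rewrite /strip /side /=; (split; first by apply/cdiskP; split; lra);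
  try split; lra.
Qed.

Lemma strip_model :
  tangle_model (tangle_parallel R) strip strip_base (@set0 (crossing R strips)).
Proof.
have k2 (S : R -> R -> Prop) (k : nat) y : (k < 2)%N ->
    S (1 / 2) y -> S (- (1 / 2)) y -> S ((-1) ^+ k / 2) y.
  by case: k => [|[|//]] _; rewrite ?expr0 ?expr1 ?mulN1r ?mulNr ?div1r // mul1r.
split=> //.
- move=> k t kn /andP[t1 t2] /=; apply: (k2 (fun z t => odisk (t, z))) => //;
    apply/odiskP; split; lra.
- move=> k kn /=; split; [apply: (k2 (fun z t => bdisk (t, z))) => //
    |apply: (k2 (fun z t => bdisk (t, z))) => //]; apply/bdiskP;
  by [apply/cdiskP; split; lra|apply: Or41|apply: Or42].
- case=> /=; rewrite /strip; try exact: open_side.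
  by apply: openI; exact: open_side.
- move=> j j' [x y] _; rewrite /strip /side /=.
  by case: j; case: j' => //=; [move=> + []|move=> + ?|move=> [] + + ?
    |move=> [] + + ?|move=> + ?|move=> + []]; move=> *; exfalso; lra.
- exact: strip_base_in.
- move=> j x cx Px; have [cb Pb] := strip_base_in j.
  apply: joined_segment => t Ht; split; last exact: cdisk_convex.
  case: j {cb} Px Pb => /=; try by move=> *; apply: side_convex => //; lra.
  by move=> [H1 H2] [H3 H4]; split; apply: side_convex => //; lra.
- move=> j k t kn _; apply: (k2 (fun z t => ~ strip j (t, z))) => //;
    case: j; rewrite /strip /side /=; try lra; case; lra.
- case=> x y /cdiskP [x1 x2 y1 y2]; have Hx : -1 <= x <= 1 by rewrite x1.
  case: (ltgtP y (1 / 2)) => H0; last first.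
  + by right; exists 0%N, x; rewrite /= expr0 -H0.
  + by left; exists Ptop; rewrite /strip /side /=; lra.
  case: (ltgtP y (- (1 / 2))) => H1; last first.
  + by right; exists 1%N, x; split=> //=; congr pair; rewrite expr1; lra.
  + by left; exists Pmid; rewrite /strip /side /=; split; lra.
  by left; exists Pbot; rewrite /strip /side /=; lra.
Qed.

Let y0 (x : R) : R := (4 * x ^+ 2 - 1) / 6.

Lemma bigon_pieceP j x y : bigon_piece j (x, y) <->
  match j with
  | Btop => y0 x < y /\ - y0 x < y
  | Bbot => y < y0 x /\ y < - y0 x
  | Bmid => y0 x < y /\ y < - y0 x
  | Bleft => [/\ y < y0 x, - y0 x < y & x < 0]
  | Bright => [/\ y < y0 x, - y0 x < y & 0 < x]
  end.
Proof.
rewrite /y0; case: j; rewrite /bigon_piece /side /=; split.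
all: by [move=> [[? ?] ?]; split; lra|move=> [? ?]; split; lra
  |move=> [? ? ?]; split; [split|]; lra].
Qed.

Lemma bigon_strand k t : (k < 2)%N -> strand (tangle_bigon R m) k t =
  (t, if k == 0%N then y0 t else - y0 t).
Proof.
by rewrite /y0; case: k => [|[|//]] _ /=; congr pair;
  rewrite ?expr0 ?expr1; lra.
Qed.

Lemma bigon_base_in j : cdisk (bigon_base j) /\ bigon_piece j (bigon_base j).
Proof.
split; first by case: j; apply/cdiskP; split; lra.
by case: j; apply/bigon_pieceP; rewrite /y0; split; lra.
Qed.

Lemma bigon_joined j x : cdisk x -> bigon_piece j x ->
  joined (bigon_piece j `&` @cdisk R) (bigon_base j) x.
Proof.
case: x => x y cx Px; have [cb Pb] := bigon_base_in j.
case: (pselect (j = Bmid)) => [Ej|jm].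
  apply: joined_segment => t Ht; split; last exact: cdisk_convex.
  by move: Px Pb; rewrite Ej => -[H1 H2] [H3 H4]; split;
    apply: side_convex => //; lra.
apply: joined_sym; clear Pb cb.
move/cdiskP: (cx) => [x1 x2 y1 y2]; move/bigon_pieceP: (Px) => H.
rewrite /bigon_base; case: j Px jm H => // Px _ H.
- apply: (joined_trans (joined_cdisk_v (b := 1) _ _ _)); last apply: joined_cdisk_h;
    try by apply/cdiskP; split; lra.
    by move=> s Hs; apply/bigon_pieceP; case/orP: Hs => /andP[? ?]; split; lra.
  move=> s Hs; apply/bigon_pieceP.
  have Hs1 : s ^+ 2 <= 1 by case/orP: Hs => /andP[? ?]; nra.
  by have := sqr_ge0 s; rewrite /y0; split; lra.
- move: H => [H1 H2 H3].
  apply: (joined_trans (joined_cdisk_h (b := -1) _ _ _)); last apply: joined_cdisk_v;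
    try by apply/cdiskP; split; lra.
    move=> s Hs; have Hs1 : x ^+ 2 <= s ^+ 2 by case/orP: Hs => /andP[? ?]; nra.
    have Hs0 : s < 0 by case/orP: Hs => /andP[? ?]; lra.
    by apply/bigon_pieceP; move: H1 H2; rewrite /y0 => H1 H2; split; lra.
  have Hx1 : x ^+ 2 <= 1 by nra.
  by move: H1 H2; rewrite /y0 => H1 H2 s Hs; apply/bigon_pieceP; rewrite /y0;
    case/orP: Hs => /andP[? ?]; split; lra.
- move: H => [H1 H2 H3].
  apply: (joined_trans (joined_cdisk_h (b := 1) _ _ _)); last apply: joined_cdisk_v;
    try by apply/cdiskP; split; lra.
    move=> s Hs; have Hs1 : x ^+ 2 <= s ^+ 2 by case/orP: Hs => /andP[? ?]; nra.
    have Hs0 : 0 < s by case/orP: Hs => /andP[? ?]; lra.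
    by apply/bigon_pieceP; move: H1 H2; rewrite /y0 => H1 H2; split; lra.
  have Hx1 : x ^+ 2 <= 1 by nra.
  by move: H1 H2; rewrite /y0 => H1 H2 s Hs; apply/bigon_pieceP; rewrite /y0;
    case/orP: Hs => /andP[? ?]; split; lra.
- apply: (joined_trans (joined_cdisk_v (b := -1) _ _ _)); last apply: joined_cdisk_h;
    try by apply/cdiskP; split; lra.
    by move=> s Hs; apply/bigon_pieceP; case/orP: Hs => /andP[? ?]; split; lra.
  move=> s Hs; apply/bigon_pieceP.
  have Hs1 : s ^+ 2 <= 1 by case/orP: Hs => /andP[? ?]; nra.
  by have := sqr_ge0 s; rewrite /y0; split; lra.
Qed.

Lemma bigon_derive k t : (k < 2)%N ->
  derive1 (strand (tangle_bigon R m) k) t =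
  (1, if k == 0%N then 4 / 3 * t else - (4 / 3 * t)).
Proof.
case: k => [|[|//]] _ /=.
- rewrite (@derive1_poly _ 'X ((2 / 3)%:P * 'X^2 - (1 / 6)%:P)) => [|s].
    by rewrite !poly.derivE !hornerE; congr pair; lra.
  by rewrite !(hornerD, hornerN, hornerM, hornerC, hornerXn, hornerX) expr0;
    congr pair; lra.
- rewrite (@derive1_poly _ 'X ((1 / 6)%:P - (2 / 3)%:P * 'X^2)) => [|s].
    by rewrite !poly.derivE !hornerE; congr pair; lra.
  by rewrite !(hornerD, hornerN, hornerM, hornerC, hornerXn, hornerX) expr1;
    congr pair; lra.
Qed.

Lemma bigon_cover x : cdisk x -> (exists j, bigon_piece j x) \/
  exists k t, [/\ (k < 2)%N, -1 <= t <= 1 & strand (tangle_bigon R m) k t = x].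
Proof.
case: x => x y /cdiskP [x1 x2 ? ?]; have Hx : -1 <= x <= 1 by rewrite x1.
case: (ltgtP y (y0 x)) => H0; last first.
+ by right; exists 0%N, x; rewrite bigon_strand //= -H0.
all: case: (ltgtP y (- y0 x)) => H1;
  last by right; exists 1%N, x; rewrite bigon_strand //= -H1.
all: left; try by [exists Bbot; apply/bigon_pieceP|exists Bmid; apply/bigon_pieceP|
  exists Btop; apply/bigon_pieceP].
case: (ltgtP x 0) => H2; [exists Bleft|exists Bright|]; try exact/bigon_pieceP.
by exfalso; move: H0 H1; rewrite /y0 H2; lra.
Qed.

Lemma bigon_model :
  tangle_model (tangle_bigon R m) bigon_piece bigon_base bigon_crossings.
Proof.
have dE (u v w : R) : v = w -> (u, v) = (u, w) by move=> ->.
have ht : -1 < (1 / 2 : R) < 1 by apply/andP; split; lra.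
have ht' : -1 < (- (1 / 2) : R) < 1 by apply/andP; split; lra.
have nh : (1 / 2 == - (1 / 2) :> R) = false by apply/eqP; lra.
split.
- move=> k t kn /andP[t1 t2]; rewrite bigon_strand // /y0; apply/odiskP.
  by case: ifP => _; split; nra.
- move=> k kn; rewrite !bigon_strand // /y0; split; apply/bdiskP;
  by [apply/cdiskP; case: ifP => _; split; lra|apply: Or41|apply: Or42].
- by case=> /=; do ?[apply: openI]; exact: open_side.
- move=> j j' [x y] _ /bigon_pieceP + /bigon_pieceP.
  by case: j; case: j' => // H H'; exfalso; destruct H, H'; lra.
- exact: bigon_base_in.
- exact: bigon_joined.
- move=> j k t kn _; rewrite bigon_strand // => /bigon_pieceP.
  by case: ifP => _; case: j => -[] *; lra.
- exact: bigon_cover.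
- by move=> c [] ->; apply/odiskP; split; lra.
- by move=> c [] -> //=; apply: swap_neq_Simple.
- by move=> c [] ->; rewrite /det2 /=; lra.
- move=> c [] ->; [exists (- (1 / 2))|exists (1 / 2)]; split=> //.
  + by rewrite bigon_strand //= /y0; apply: dE; lra.
  + by rewrite bigon_derive //=; apply: dE; lra.
  + by rewrite /= eqxx.
  + by rewrite bigon_strand //= /y0; apply: dE; lra.
  + by rewrite bigon_derive //=; apply: dE; lra.
  + by rewrite /= eqxx orbT.
- move=> c [] ->; [exists (- (1 / 2))|exists (1 / 2)]; split=> //.
  + by rewrite bigon_strand //= /y0; apply: dE; lra.
  + by rewrite bigon_derive //=; apply: dE; lra.
  + by rewrite /= eqxx.
  + by rewrite bigon_strand //= /y0; apply: dE; lra.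
  + by rewrite bigon_derive //=; apply: dE; lra.
  + by rewrite /= eqxx orbT swapK.
- move=> c a b [] -> a0 b0; split; rewrite /bigon_piece /=;
  do ?[apply: into_setI]; apply: into_side_or; rewrite /= /GRing.scale /=;
  first [left; split; lra|right; lra].
- move=> c k t [] -> kn _; rewrite bigon_strand // bigon_derive //=.
  + case: k kn => [|[|//]] _ [-> _] /=; rewrite eqxx /=; [left|right]; split=> //;
    by apply: dE; lra.
  + case: k kn => [|[|//]] _ [-> _] /=; rewrite eqxx orbT ?swapK; [right|left];
    by split=> //; apply: dE; lra.
- move=> k t kn _; rewrite bigon_strand //=.
  case: eqP => [-> _|_] /=.
    by exists bigon_crossing1; [left|apply: dE; rewrite /y0; case: ifP => _; lra].
  case: eqP => [-> _|//].
  by exists bigon_crossing2; [right|apply: dE; rewrite /y0; case: ifP => _; lra].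
Qed.

End Bigon.

Definition bigon_arcs (j : strips) (j' : bigon_pieces) : Prop :=
  match j, j' with
  | Ptop, Btop | Pmid, Bleft | Pmid, Bright | Pbot, Bbot => True
  | _, _ => False
  end.

Section BigonMove.
Variables (R : realType) (X : Type) (tri vir : X -> X -> X -> X).
Hypothesis HX : virtual_tribracket tri vir.
Variable m : passage.
Hypothesis m_neq : m <> Simple.

(** The parabolas are even in [x]: with [x ^+ 2] as an unknown, the comparisons on the boundary
    become linear. *)
Lemma bdisk_sqr (x y : R) : bdisk (x, y) ->
  [/\ -1 <= x, x <= 1, 0 <= x ^+ 2, x ^+ 2 <= 1 &
     [\/ x ^+ 2 = 1, y = 1 | y = -1]].
Proof.
move=> Hx; have cx := Hx.1; move/(bdiskP cx): Hx; move/cdiskP: cx => [? ? ? ?] Hb.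
split=> //; [exact: sqr_ge0|nra|].
by case: Hb => ->; [apply: Or31; ring|apply: Or31; ring|apply: Or33|apply: Or32].
Qed.

Lemma bigon_arcs_boundary j j' (x : R * R) : bdisk x ->
  strip j x -> bigon_piece j' x -> bigon_arcs j j'.
Proof.
case: x => x y /bdisk_sqr [x1 x2 x20 x21 Hb] Pj /bigon_pieceP Pj'.
case: j Pj; rewrite /strip /side /=; [move=> H1|move=> [H1 H2]|move=> H1];
  case: j' Pj' => // H'; exfalso; destruct H'; case: Hb => E; lra.
Qed.

Lemma bigon_of_strip j (x : R * R) : bdisk x -> strip j x ->
  exists2 j', bigon_arcs j j' & bigon_piece j' x.
Proof.
case: x => x y /bdisk_sqr [x1 x2 x20 x21 Hb]; case: j; rewrite /strip /side /= => Pj.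
- by exists Btop => //; apply/bigon_pieceP; split; lra.
- have {}Hb : x ^+ 2 = 1 by case: Pj => ? ?; case: Hb => // E; lra.
  case: Pj => ? ?; case: (lerP x 0) => Hx; [exists Bleft|exists Bright] => //;
    apply/bigon_pieceP; split; try lra.
  by rewrite lt_def Hx andbT; apply/eqP => E; rewrite -E in Hb; lra.
- by exists Bbot => //; apply/bigon_pieceP; split; lra.
Qed.

Lemma strip_of_bigon j' (x : R * R) : bdisk x -> bigon_piece j' x ->
  exists j, strip j x.
Proof.
case: x => x y /bdisk_sqr [x1 x2 x20 x21 Hb] /bigon_pieceP.
case: j' => H; [exists Ptop|exists Pmid|exists Pmid|exists Pmid|exists Pbot];
  rewrite /strip /side /=; destruct H; case: Hb => E; try split; lra.
Qed.

Lemma bigon_arcsP j j' : bigon_arcs j j' <->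
  exists x, [/\ bdisk x, @strip R j x & bigon_piece j' x].
Proof.
split=> [H|[x [Hx Pj Pj']]]; last exact: bigon_arcs_boundary Hx Pj Pj'.
exists (bigon_base R j'); have [cb Pb] := bigon_base_in R j'; split=> //.
  case: j' cb H {Pb} => cb H; apply/bdiskP => //; case: j H => // _;
  by [apply: Or41|apply: Or42|apply: Or43|apply: Or44].
by case: j j' H {cb Pb} => -[] //= _; rewrite /side /=; try split; lra.
Qed.

Lemma bigon_crossings_rel rev (col : bigon_pieces -> X) :
  (forall c, @bigon_crossings R m c -> crossing_rel tri vir rev col c) <->
  rel tri vir m (rev 0%N) (rev 1%N) (col Btop) (col Bleft) (col Bbot) (col Bmid) /\
  rel tri vir m (rev 0%N) (rev 1%N) (col Btop) (col Bright) (col Bbot) (col Bmid).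
Proof.
split=> [H|[H1 H2] c [] ->].
- by have H1 := H _ (or_introl erefl); have /(rel_flip HX) := H _ (or_intror erefl).
- exact: H1.
- exact/(rel_flip HX).
Qed.

Lemma bigon_transfer :
  colorings_transfer tri vir (tangle_parallel R) (tangle_bigon R m).
Proof.
apply: (model_transfer (strip_model R) (bigon_model R m_neq) bigon_arcsP).
- move=> x Hx; split=> -[j Pj]; last exact: strip_of_bigon Pj.
  by have [j' _ Pj'] := bigon_of_strip Hx Pj; exists j'.
- move=> rev col _.
  have [y [Hy _]] := rel_out HX (rev 0%N) (rev 1%N) (col Ptop) (col Pmid) (col Pbot) m_neq.
  exists (fun j => match j with
    | Btop => col Ptop | Bleft | Bright => col Pmid | Bbot => col Pbot
    | Bmid => y end).
  by split; [exact/bigon_crossings_rel|case=> -[]].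
- move=> rev col1 col2 /bigon_crossings_rel [H1 _] /bigon_crossings_rel [H2 _] E.
  have Et : col1 Btop = col2 Btop by apply: (E Ptop).
  have El : col1 Bleft = col2 Bleft by apply: (E Pmid).
  have Er : col1 Bright = col2 Bright by apply: (E Pmid).
  have Eb : col1 Bbot = col2 Bbot by apply: (E Pbot).
  case=> //; rewrite Et El Eb in H1.
  have [z [_ Hz]] := rel_out HX (rev 0%N) (rev 1%N) (col2 Btop) (col2 Bleft)
    (col2 Bbot) m_neq.
  by rewrite -(Hz _ H1) -(Hz _ H2).
Qed.

Lemma parallel_transfer :
  colorings_transfer tri vir (tangle_bigon R m) (tangle_parallel R).
Proof.
apply: (model_transfer (arcs := fun j j' => bigon_arcs j' j)
  (bigon_model R m_neq) (strip_model R)).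
- move=> j j'; rewrite bigon_arcsP; split=> -[x [? ? ?]]; by exists x.
- move=> x Hx; split=> -[j Pj]; first exact: strip_of_bigon Pj.
  by have [j' _ Pj'] := bigon_of_strip Hx Pj; exists j'.
- move=> rev col /bigon_crossings_rel [H1 H2].
  (* The left and right pieces merge when the bigon is removed; they have the same color because
     both solve the same division. *)
  have [z [_ Hz]] := rel_in HX (rev 0%N) (rev 1%N) (col Btop) (col Bbot) (col Bmid) m_neq.
  have Elr : col Bleft = col Bright by rewrite -(Hz _ H1) -(Hz _ H2).
  exists (fun j => match j with
    | Ptop => col Btop | Pmid => col Bleft | Pbot => col Bbot end).
  by split=> // -[] -[].
- move=> rev col1 col2 _ _ E -[].
  + exact: (E Btop).
  + exact: (E Bleft).
  + exact: (E Bbot).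
Qed.

End BigonMove.

(** * Move I *)

Inductive strand_pieces := Sin | Sout.
Inductive kink_pieces := Kin | Kout | Kloop.

Section Kink.
Variables (R : realType) (m : passage).
Hypothesis m_neq : m <> Simple.

Definition strand_piece (j : strand_pieces) : set (R * R) :=
  match j with
  | Sin => [set x | 0 < x.1 - 4 * x.2 ^+ 2]
  | Sout => [set x | 0 < 4 * x.2 ^+ 2 - x.1]
  end.

Definition strand_base (j : strand_pieces) : R * R :=
  match j with Sin => (1, 0) | Sout => (-1, 0) end.

(* The kink is the part of the nodal cubic [cubic x = 0] that lies in the disk. *)
Definition cubic (x : R * R) : R := 16 * x.2 ^+ 2 - x.1 ^+ 2 * (3 * x.1 + 1).

Definition kink_piece (j : kink_pieces) : set (R * R) :=
  match j with
  | Kin => [set x | cubic x < 0] `&` side 0 0 1 0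
  | Kout => [set x | 0 < cubic x]
  | Kloop => [set x | cubic x < 0] `&` side 0 0 (-1) 0
  end.

(** The loop meets the horizontal axis between [-1/3] and [0]; its base point is the midpoint. *)
Definition kink_base (j : kink_pieces) : R * R :=
  match j with Kin => (1, 0) | Kout => (-1, 0) | Kloop => (- (1 / 6), 0) end.

(** The branch at time [1 / 2] must come first for the basis to be direct, hence the role [swap m].
    The incoming and outgoing quadrants lie in the same outer piece. *)
Definition kink_crossing : crossing R kink_pieces :=
  Crossing (0, 0) 0 0 (swap m) (4 / 3, 1 / 3) (- (4 / 3), 1 / 3)
    Kloop Kout Kin Kout.

Lemma cubic_continuous : continuous cubic.
Proof.
move=> x; apply: cvgB.
  apply: cvgM; first exact: cvg_cst.
  by apply: (@cvgM _ _ _ _ snd snd); exact: cvg_snd.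
apply: cvgM; first by apply: (@cvgM _ _ _ _ fst fst); exact: cvg_fst.
apply: cvgD; last exact: cvg_cst.
by apply: cvgM; [exact: cvg_cst|exact: cvg_fst].
Qed.

Lemma open_strand_piece j : open (strand_piece j).
Proof.
have sq (x : R * R) : 4 * y.2 ^+ 2 @[y --> x] --> 4 * x.2 ^+ 2.
  apply: cvgM; first exact: cvg_cst.
  by apply: (@cvgM _ _ _ _ snd snd); exact: cvg_snd.
case: j.
- apply: (@open_comp _ _ (fun x : R * R => x.1 - 4 * x.2 ^+ 2) [set y | 0 < y]);
    last exact: open_gt.
  by move=> x _; apply: cvgB; [exact: cvg_fst|exact: sq].
- apply: (@open_comp _ _ (fun x : R * R => 4 * x.2 ^+ 2 - x.1) [set y | 0 < y]);
    last exact: open_gt.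
  by move=> x _; apply: cvgB; [exact: sq|exact: cvg_fst].
Qed.

Lemma open_kink_piece j : open (kink_piece j).
Proof.
have oN : open [set x | cubic x < 0].
  apply: (@open_comp _ _ cubic [set y | y < 0]); last exact: open_lt.
  by move=> x _; exact: cubic_continuous.
case: j => /=.
- by apply: openI => //; exact: open_side.
- apply: (@open_comp _ _ cubic [set y | 0 < y]); last exact: open_gt.
  by move=> x _; exact: cubic_continuous.
- by apply: openI => //; exact: open_side.
Qed.

Lemma strand_base_in j : cdisk (strand_base j) /\ strand_piece j (strand_base j).
Proof. by case: j; split; try (apply/cdiskP; split); rewrite /=; lra. Qed.

Lemma kink_base_in j : cdisk (kink_base j) /\ kink_piece j (kink_base j).
Proof.
split; first by case: j; apply/cdiskP; split; lra.
by case: j; rewrite /kink_piece /cubic /side /=; try split; lra.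
Qed.

Lemma strand_model : tangle_model (tangle_strand R) strand_piece strand_base
  (@set0 (crossing R strand_pieces)).
Proof.
split=> //.
- by move=> k t _ /andP[? ?]; apply/odiskP; split; nra.
- move=> k _; split; apply/bdiskP; by [apply/cdiskP; split; lra|apply: Or42; ring].
- exact: open_strand_piece.
- by move=> j j' [x y] _; case: j; case: j' => //= *; exfalso; lra.
- exact: strand_base_in.
- move=> j [x y] cx Px; have [cb Pb] := strand_base_in j; apply: joined_sym.
  move/cdiskP: (cx) => [? ? ? ?].
  case: j cb Px {Pb} => /= cb Px.
    apply: (joined_trans (y := (1, y) : R * R)).
      apply: joined_cdisk_h => // [|s Hs]; first by apply/cdiskP; split; lra.
      by case/orP: Hs => /andP[? ?] /=; lra.
    apply: joined_cdisk_v => // [|s Hs]; first by apply/cdiskP; split; lra.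
    by case/orP: Hs => /andP[? ?] /=; nra.
  apply: (joined_trans (y := (-1, y) : R * R)).
    apply: joined_cdisk_h => // [|s Hs]; first by apply/cdiskP; split; lra.
    by case/orP: Hs => /andP[? ?] /=; lra.
  apply: joined_cdisk_v => // [|s Hs]; first by apply/cdiskP; split; lra.
  by have := sqr_ge0 s; rewrite /=; lra.
- by move=> j k t _ _; case: j => /=; rewrite expr_div_n; lra.
- case=> x y /cdiskP [? ? ? ?]; case: (ltgtP x (4 * y ^+ 2)) => H.
  + by left; exists Sout; rewrite /=; lra.
  + by left; exists Sin; rewrite /=; lra.
  + right; exists 0%N, (2 * y); split=> //=; first by apply/andP; split; nra.
    by rewrite H; apply: injective_projections => /=; field.
Qed.

(** The picture is symmetric about the horizontal axis. Points of [Kin] and [Kloop] move vertically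
    to the axis; points of [Kout] move vertically away from it to the border, then along the border
    through a left corner. *)
Lemma kink_joined j x : cdisk x -> kink_piece j x ->
  joined (kink_piece j `&` @cdisk R) (kink_base j) x.
Proof.
case: x => x y cx Px; have [cb _] := kink_base_in j; apply: joined_sym.
move/cdiskP: (cx) => [x1 x2 y1 y2].
have c0 a : -1 <= a <= 1 -> cdisk (a, 0 : R).
  by move=> /andP[? ?]; apply/cdiskP; split; lra.
case: j cb Px; rewrite /kink_base /kink_piece /cubic /side /= => cb Px.
- case: Px => H1 H2; apply: (joined_trans (y := (x, 0) : R * R)).
    apply: joined_cdisk_v => // [|s Hs]; first by apply: c0; rewrite x1.
    have Hsy : s ^+ 2 <= y ^+ 2 by case/orP: Hs => /andP[? ?]; nra.
    by split=> /=; lra.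
  apply: joined_cdisk_h => // [|s Hs]; first by apply: c0; rewrite x1.
  have s0 : 0 < s by case/orP: Hs => /andP[? ?]; lra.
  have s20 : 0 < s ^+ 2 * (3 * s + 1) by rewrite mulr_gt0 // ?exprn_gt0 //; lra.
  by split=> /=; lra.
- pose z : R := if 0 <= y then 1 else -1.
  have z2 : z ^+ 2 = 1 by rewrite /z; case: ifP => _; ring.
  have cz a : -1 <= a <= 1 -> cdisk (a, z).
    by move=> /andP[? ?]; apply/cdiskP; rewrite /z; case: ifP => _; split; lra.
  apply: (joined_trans (y := (x, z) : R * R)).
    apply: joined_cdisk_v => // [|s Hs]; first by apply: cz; rewrite x1.
    have Hsy : y ^+ 2 <= s ^+ 2.
      move: Hs; rewrite /z; case: (lerP 0 y) => y0 Hs.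
        have ys : y <= s by case/orP: Hs => /andP[? ?]; lra.
        have : 0 <= (s - y) * (s + y) by apply: mulr_ge0; lra.
        lra.
      have ys : s <= y by case/orP: Hs => /andP[? ?]; lra.
      have : 0 <= (y - s) * (- s - y) by apply: mulr_ge0; lra.
      lra.
    by rewrite /=; lra.
  apply: (joined_trans (y := (-1, z) : R * R)).
    apply: joined_cdisk_h => // [||s Hs]; try by apply: cz; apply/andP; split; lra.
    have s1 : s ^+ 2 * (3 * s + 1) <= 4.
      by case/orP: Hs => /andP[? ?]; nra.
    by rewrite /= z2; lra.
  apply: joined_cdisk_v => // [|s Hs]; first by apply: cz; apply/andP; split; lra.
  by have := sqr_ge0 s; rewrite /=; lra.
- case: Px => H1 H2; apply: (joined_trans (y := (x, 0) : R * R)).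
    apply: joined_cdisk_v => // [|s Hs]; first by apply: c0; rewrite x1.
    have Hsy : s ^+ 2 <= y ^+ 2 by case/orP: Hs => /andP[? ?]; nra.
    by split=> /=; lra.
  apply: joined_cdisk_h => // [|s Hs]; first by apply: c0; rewrite x1.
  have x3 : 0 < 3 * x + 1.
    rewrite ltNge; apply/negP => x3; have := sqr_ge0 y; have := sqr_ge0 x; nra.
  have s0 : s < 0 /\ 0 < 3 * s + 1 by case/orP: Hs => /andP[? ?]; split; lra.
  have s20 : 0 < s ^+ 2 * (3 * s + 1).
    by case: s0 => s0 s3; rewrite mulr_gt0 // exprn_even_gt0 //= lt_eqF.
  by case: s0 => ? ?; split=> /=; lra.
Qed.

Lemma kink_derive k t : derive1 (strand (tangle_kink R m) k) t =
  (8 / 3 * t, 2 * t ^+ 2 - 1 / 6).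
Proof.
rewrite /= (@derive1_poly _ ((4 / 3)%:P * 'X^2 - (1 / 3)%:P)
  ('X * ((2 / 3)%:P * 'X^2 - (1 / 6)%:P))) => [|s].
  by rewrite !poly.derivE !hornerE /=; congr pair; lra.
rewrite !(hornerD, hornerN, hornerM, hornerC, hornerXn, hornerX).
by congr pair; lra.
Qed.

Lemma cubic_strand k t : cubic (strand (tangle_kink R m) k t) = 0.
Proof. by rewrite /cubic /=; field. Qed.

Lemma kink_zero t : (4 * t ^+ 2 - 1) / 3 = 0 :> R -> t = - (1 / 2) \/ t = 1 / 2.
Proof.
move=> H; have : (t + 1 / 2) * (t - 1 / 2) = 0 by lra.
by move/eqP; rewrite mulf_eq0 => /orP[] /eqP E; [left|right]; lra.
Qed.

Lemma kink_cover x : cdisk x -> (exists j, kink_piece j x) \/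
  exists k t, [/\ (k < 1)%N, -1 <= t <= 1 & strand (tangle_kink R m) k t = x].
Proof.
case: x => x y /cdiskP [x1 x2 y1 y2].
case: (ltgtP (cubic (x, y)) 0) => H; first 1 last.
- by left; exists Kout.
- right; exists 0%N; case: (eqVneq x 0) => [E|xn].
    have y0 : y = 0.
      by apply/eqP; rewrite -sqrf_eq0; apply/eqP; move: H; rewrite /cubic /= E; lra.
    exists (1 / 2); split=> //; first by apply/andP; split; lra.
    by rewrite E y0 /=; congr pair; lra.
  (* Off the node the time is [2 * y / x], since the second coordinate of the strand is half the
     time multiplied by the first. *)
  have Ht : (2 * y / x) ^+ 2 = (3 * x + 1) / 4.
    have E : (2 * y) ^+ 2 = x ^+ 2 * ((3 * x + 1) / 4).
      by move: H; rewrite /cubic /= => H; lra.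
    by rewrite expr_div_n E mulrAC divff ?mul1r // expf_neq0.
  exists (2 * y / x); split=> //; first by apply/andP; split; nra.
  by rewrite /= Ht; congr pair; [lra|field].
- left; case: (ltgtP x 0) => Hx; [exists Kloop|exists Kin|]; rewrite /kink_piece /side /=;
    try by split=> //; lra.
  by move: H; rewrite /cubic /= Hx; have := sqr_ge0 y; lra.
Qed.

(** At the node the cubic vanishes to second order, so the first-order test of [into_side] is
    silent. Divided by [e ^+ 2], the cubic tends to its quadratic part, whose zeros are the two
    tangent lines. *)
Lemma cubic_ray (a b : R -> R) (w : R * R) :
  a e @[e --> 0^'+] --> w.1 -> b e @[e --> 0^'+] --> w.2 ->
  16 * (b e * b e) - a e * a e * (3 * (e * a e) + 1) @[e --> 0^'+] -->
  16 * w.2 ^+ 2 - w.1 ^+ 2.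
Proof.
move=> Ha Hb; have e0 : e @[e --> 0^'+] --> (0 : R).
  by apply: cvg_at_right_filter; exact: cvg_id.
have -> : 16 * w.2 ^+ 2 - w.1 ^+ 2 =
    16 * (w.2 * w.2) - w.1 * w.1 * (3 * (0 * w.1) + 1) by ring.
apply: cvgB; first by apply: cvgM; [exact: cvg_cst|exact: cvgM].
apply: cvgM; first exact: cvgM.
apply: cvgD; last exact: cvg_cst.
by apply: cvgM; [exact: cvg_cst|exact: cvgM].
Qed.

Lemma cubic_rayE (a b e : R) : cubic (0 + e * a, 0 + e * b) =
  e ^+ 2 * (16 * (b * b) - a * a * (3 * (e * a) + 1)).
Proof. by rewrite /cubic /=; ring. Qed.

Lemma into_cubic_pos (w : R * R) : 0 < 16 * w.2 ^+ 2 - w.1 ^+ 2 ->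
  into [set x | 0 < cubic x] (0, 0) w.
Proof.
move=> d0 a b Ha Hb.
have Q := @cvgr_gt _ _ _ (at_right_proper_filter (0 : R)) _ _ (cubic_ray Ha Hb) _ d0.
have P : \forall e \near 0^'+, (0 : R) < e by exact: nbhs_right_gt.
apply: filterS2 P Q => e ep He; rewrite /= cubic_rayE.
by rewrite mulr_gt0 // exprn_gt0.
Qed.

Lemma into_cubic_neg (w : R * R) : 16 * w.2 ^+ 2 - w.1 ^+ 2 < 0 ->
  into [set x | cubic x < 0] (0, 0) w.
Proof.
move=> d0 a b Ha Hb.
have Q := @cvgr_lt _ _ _ (at_right_proper_filter (0 : R)) _ _ (cubic_ray Ha Hb) _ d0.
have P : \forall e \near 0^'+, (0 : R) < e by exact: nbhs_right_gt.
apply: filterS2 P Q => e ep He; rewrite /= cubic_rayE.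
by rewrite nmulr_llt0 // exprn_gt0.
Qed.

Lemma kink_model : tangle_model (tangle_kink R m) kink_piece kink_base
  [set c | c = kink_crossing].
Proof.
have dE (u u' v v' : R) : u = u' -> v = v' -> (u, v) = (u', v') by move=> -> ->.
have ht : -1 < (1 / 2 : R) < 1 by apply/andP; split; lra.
have ht' : -1 < (- (1 / 2) : R) < 1 by apply/andP; split; lra.
have nh : (1 / 2 == - (1 / 2) :> R) = false by apply/eqP; lra.
split.
- by move=> k t _ /andP[? ?]; apply/odiskP; split; nra.
- move=> k _; split; apply/bdiskP;
  by [apply/cdiskP; split; lra|apply: Or42; lra].
- exact: open_kink_piece.
- move=> j j' [x y] _; case: j; case: j'; rewrite /kink_piece /side //= => H H';
  exfalso; try case: H => ? ?; try case: H' => ? ?; lra.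
- exact: kink_base_in.
- exact: kink_joined.
- move=> j k t _ _ H; have := cubic_strand k t.
  by case: j H => [[H _]|H|[H _]] E; rewrite /= E ltxx in H.
- exact: kink_cover.
- by move=> c ->; apply/odiskP; split; lra.
- by move=> c ->; exact: swap_neq_Simple.
- by move=> c ->; rewrite /det2 /=; lra.
- move=> c ->; exists (1 / 2); split=> //.
  + by apply: dE; lra.
  + by rewrite kink_derive; apply: dE; lra.
  + by rewrite /= nh eqxx.
- move=> c ->; exists (- (1 / 2)); split=> //.
  + by apply: dE; lra.
  + by rewrite kink_derive; apply: dE; lra.
  + by rewrite /= eqxx swapK.
- move=> c a b -> a0 b0; have ab0 := mulr_gt0 a0 b0.
  split.
  + by apply: into_setI; [apply: into_cubic_neg; rewrite /= /GRing.scale /=; lra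
      |apply: into_side_or; left; rewrite /= /GRing.scale /=; split; lra].
  + by apply: into_cubic_pos; rewrite /= /GRing.scale /=; lra.
  + by apply: into_setI; [apply: into_cubic_neg; rewrite /= /GRing.scale /=; lra
      |apply: into_side_or; left; rewrite /= /GRing.scale /=; split; lra].
  + by apply: into_cubic_pos; rewrite /= /GRing.scale /=; lra.
- move=> c k t -> k0 _ E; rewrite kink_derive.
  have [Et|Et] : t = - (1 / 2) \/ t = 1 / 2.
  + by apply: kink_zero; move/(congr1 fst): E.
  + right; rewrite Et /= eqxx swapK; split=> //; first by case: k k0 {E}.
    by apply: dE; lra.
  + left; rewrite Et /= nh eqxx; split=> //; first by case: k k0 {E}.
    by apply: dE; lra.
- move=> k t _ _ /= Hm; exists kink_crossing => //; apply: dE; move: Hm;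
  by case: eqP => [-> _|_]; [lra|case: eqP => [-> _|//]; lra].
Qed.

End Kink.

Definition kink_arcs (j : strand_pieces) (j' : kink_pieces) : Prop :=
  match j, j' with Sin, Kin | Sout, Kout => True | _, _ => False end.

Section KinkMove.
Variables (R : realType) (X : Type) (tri vir : X -> X -> X -> X).
Hypothesis HX : virtual_tribracket tri vir.
Variable m : passage.
Hypothesis m_neq : m <> Simple.

(** The cases in which the curves are compared: on the side [x = 1] the cubic equals 4 times
    [4 y^2 - x], and on the rest of the boundary both are positive. Hence arc and kink cut the
    boundary alike. *)
Lemma kink_boundary (x y : R) : bdisk (x, y) ->
  [/\ 0 <= y ^+ 2, x ^+ 2 * (3 * x + 1) <= 4 &
     [\/ x = -1, x = 1 | y ^+ 2 = 1 /\ x < 1]].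
Proof.
move=> Hx; have cx := Hx.1; move/(bdiskP cx): Hx; move/cdiskP: cx => [? ? ? ?] Hb.
split; [exact: sqr_ge0|nra|].
have [->|x1] := eqVneq x 1; first exact: Or32.
have xl : x < 1 by rewrite lt_def eq_sym x1.
case: Hb => E; [exact: Or31|by rewrite E eqxx in x1| |];
  by apply: Or33; split=> //; rewrite E; ring.
Qed.

Lemma kink_arcs_boundary j j' (x : R * R) : bdisk x ->
  strand_piece j x -> kink_piece j' x -> kink_arcs j j'.
Proof.
case: x => x y /kink_boundary [y0 x4 Hb].
case: j; case: j' => //=; rewrite /cubic /side /= => H.
- by move=> H'; case: Hb => [E|E|[E ?]]; rewrite ?E in H H' x4; lra.
- by move=> [H1 H2]; case: Hb => [E|E|[E ?]]; rewrite ?E in H H1 H2 x4; lra.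
- by move=> [H1 H2]; case: Hb => [E|E|[E ?]]; rewrite ?E in H H1 H2 x4; lra.
- by move=> [H1 H2]; case: Hb => [E|E|[E ?]]; rewrite ?E in H H1 H2 x4; lra.
Qed.

Lemma kink_of_strand j (x : R * R) : bdisk x -> strand_piece j x ->
  exists j', kink_piece j' x.
Proof.
case: x => x y /kink_boundary [y0 x4 Hb]; case: j => /= H.
- exists Kin; rewrite /kink_piece /cubic /side /=.
  by case: Hb => [E|E|[E ?]]; rewrite ?E in H x4 *; split; lra.
- exists Kout; rewrite /kink_piece /cubic /=.
  by case: Hb => [E|E|[E ?]]; rewrite ?E in H x4 *; lra.
Qed.

Lemma strand_of_kink j' (x : R * R) : bdisk x -> kink_piece j' x ->
  exists j, strand_piece j x.
Proof.
case: x => x y /kink_boundary [y0 x4 Hb]; case: j'; rewrite /kink_piece /cubic /side /= => H.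
- exists Sin => /=; case: H => H1 H2.
  by case: Hb => [E|E|[E ?]]; rewrite ?E in H1 H2 x4 *; lra.
- exists Sout => /=.
  by case: Hb => [E|E|[E ?]]; rewrite ?E in H x4 *; lra.
- exists Sout => /=; case: H => H1 H2.
  by case: Hb => [E|E|[E ?]]; rewrite ?E in H1 H2 x4 *; lra.
Qed.

Lemma kink_arcsP j j' : kink_arcs j j' <->
  exists x, [/\ bdisk x, @strand_piece R j x & kink_piece j' x].
Proof.
split=> [H|[x [Hx Pj Pj']]]; last exact: kink_arcs_boundary Hx Pj Pj'.
exists (strand_base R j); have [cb Pb] := strand_base_in R j; split=> //.
  by case: j cb {H Pb} => cb; apply/bdiskP => //; [apply: Or42|apply: Or41].
case: j j' H {cb Pb} => -[] //= _; have [_] := kink_base_in R Kin => //.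
by have [_] := kink_base_in R Kout.
Qed.

Lemma kink_transfer :
  colorings_transfer tri vir (tangle_strand R) (tangle_kink R m).
Proof.
apply: (model_transfer (strand_model R) (kink_model R m_neq) kink_arcsP).
- move=> x Hx; split=> -[j Pj]; [exact: kink_of_strand Pj|exact: strand_of_kink Pj].
- move=> rev col _; have Hm := swap_neq_Simple m_neq.
  (* The loop is the left quadrant of a crossing whose three other quadrants have known colors. *)
  have [l [Hl _]] := rel_left HX (rev 0%N) (rev 0%N) (col Sout) (col Sin) (col Sout) Hm.
  exists (fun j => match j with Kin => col Sin | Kout => col Sout | Kloop => l end).
  by split=> [c ->|[] []].
- move=> rev col1 col2 H1 H2 E.
  have {}H1 := H1 _ erefl; have {}H2 := H2 _ erefl.
  have Ei : col1 Kin = col2 Kin by apply: (E Sin).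
  have Eo : col1 Kout = col2 Kout by apply: (E Sout).
  case=> //; rewrite /crossing_rel /= Ei Eo in H1 H2.
  have [z [_ Hz]] := rel_left HX (rev 0%N) (rev 0%N) (col2 Kout) (col2 Kin)
    (col2 Kout) (swap_neq_Simple m_neq).
  by rewrite -(Hz _ H1) -(Hz _ H2).
Qed.

Lemma strand_transfer :
  colorings_transfer tri vir (tangle_kink R m) (tangle_strand R).
Proof.
apply: (model_transfer (arcs := fun j j' => kink_arcs j' j)
  (kink_model R m_neq) (strand_model R)).
- by move=> j j'; rewrite kink_arcsP; split=> -[x [? ? ?]]; exists x.
- move=> x Hx; split=> -[j Pj]; [exact: strand_of_kink Pj|exact: kink_of_strand Pj].
- move=> rev col _.
  exists (fun j => match j with Sin => col Kin | Sout => col Kout end).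
  by split=> // -[] -[].
- move=> rev col1 col2 _ _ E -[]; [exact: (E Kin)|exact: (E Kout)].
Qed.

End KinkMove.

(** * All the moves, in both directions *)

Lemma local_move_transfer (R : realType) (X : Type) (tri vir : X -> X -> X -> X)
    (T T' : tangle R) : virtual_tribracket tri vir -> local_move T T' ->
  colorings_transfer tri vir T T' /\ colorings_transfer tri vir T' T.
Proof.
move=> HX.
have triangle role : (forall k l, k != l -> role l k = swap (role k l)) ->
    (forall k l, k != l -> role k l <> Simple) -> braid_roles tri vir role 1 2 0 ->
    colorings_transfer tri vir (tangle_triangle role 1) (tangle_triangle role (-1 : R)) /\
    colorings_transfer tri vir (tangle_triangle role (-1)) (tangle_triangle role (1 : R)).
  move=> Hswap Hneq Hbraid.
  by split; [exact: (@tri_transfer R X tri vir HX role Hswap Hneq Hbraid true)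
    |exact: (@tri_transfer R X tri vir HX role Hswap Hneq Hbraid false)].
case=> {T T'} [m Hm|m Hm|h hI||s h role s3 hI].
- by split; [exact: kink_transfer|exact: strand_transfer].
- by split; [exact: bigon_transfer|exact: parallel_transfer].
- apply: triangle; last exact: braid_classical.
    by move=> k l; exact: classical_role_swap.
  by move=> k l _; exact: classical_role_neq.
- by apply: triangle => //; exact: braid_virtual.
- apply: (triangle (mixed_role h s)); last exact: braid_mixed.
    by move=> k l; exact: mixed_role_swap.
  by move=> k l _; exact: mixed_role_neq.
Qed.

Theorem theorem2 (R : realType) (X : Type) (tri vir : X -> X -> X -> X)
    (HX : virtual_tribracket tri vir)
    (Delta : set (R * R)) (D D' : diagram R)
    (Hmove : reidemeister Delta D D')
    (f : region D -> X) (Hf : coloring tri vir f) :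
  exists! f' : region D' -> X,
    coloring tri vir f' /\ agree_outside Delta f f'.
Proof.
have [T [T' [rev [psi [phi [psi' [phi' [HT [Hc Hc'] Hpsi [HD HD'] Hout]]]]]]]] := Hmove.
suff H : colorings_transfer tri vir T T' by exact: H Hc Hc' Hpsi HD HD' Hout Hf.
by case: HT => /(local_move_transfer HX) [].
Qed.
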